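(* Let $X=\mathbb{P}^{a_1}\times\mathbb{P}^{a_2}$ with $a_1,a_2\ge 1$, and fix a configuration matrix $A$ of a CICY threefold in $X$. If $(d_1,d_2)\in\{(0,1),(1,0),(1,1)\}$, then $J_{d_1,d_2}$ is irreducible, and the generic Calabi-Yau threefold $Y$ in $X$ with configuration matrix $A$ contains at most a finite number of curves of $\mathcal{M}_{d_1,d_2}$ (i.e. for all $\underline{s}$ in some nonempty Zariski open subset of $U_A$, only finitely many $C\in\mathcal{M}_{d_1,d_2}$ satisfy $C\subset V(s_1,\dots,s_m)$).
   Context: Work over $\mathbb{C}$. Let $X=\mathbb{P}^{a_1}\times\mathbb{P}^{a_2}$ with projections $\pi_1,\pi_2$, and put $\mathcal{O}_X(b_1,b_2)=\pi_1^*\mathcal{O}_{\mathbb{P}^{a_1}}(b_1)\otimes\pi_2^*\mathcal{O}_{\mathbb{P}^{a_2}}(b_2)$. Configuration matrices. Let $m=a_1+a_2-3\ge 1$. A configuration matrix of a CICY (complete intersection Calabi-Yau) threefold in $X$ is a $2\times m$ matrix $A=(b_{ij})$ of nonnegative integers with no zero column, such that $\sum_{j=1}^m b_{ij}=a_i+1$ for $i=1,2$ (this makes $c_1$ vanish), and such that for general sections $s_j\in H^0(\mathcal{O}_X(b_{1j},b_{2j}))$, $j=1,\dots,m$, the zero locus $V(s_1,\dots,s_m)$ is a smooth irreducible complete intersection threefold. Parameter space. $\mathbb{S}_A=\prod_{j=1}^m\mathbb{P}(H^0(\mathcal{O}_X(b_{1j},b_{2j})))$, and $U_A\subset\mathbb{S}_A$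 is the open subset of those $\underline{s}=(s_1,\dots,s_m)$ for which $V(s_1,\dots,s_m)$ is a smooth complete intersection in $X$. Curves. A curve $C\subset X$ has bidegree $(d_1,d_2)$ if $\deg(\mathcal{O}_X(1,0)|_C)=d_1$ and $\deg(\mathcal{O}_X(0,1)|_C)=d_2$. $\mathcal{M}_{d_1,d_2}$ is the moduli space of smooth rational curves in $X$ of bidegree $(d_1,d_2)$: each such curve is the image of a map $(t:u)\mapsto(\alpha(t:u),\beta(t:u))$ with $\alpha\in H^0(\mathcal{O}_{\mathbb{P}^1}(d_1))^{\oplus(a_1+1)}$, $\beta\in H^0(\mathcal{O}_{\mathbb{P}^1}(d_2))^{\oplus(a_2+1)}$, and $\mathcal{M}_{d_1,d_2}$ is identified with an open set of $\left(\mathbb{P}(H^0(\mathcal{O}_{\mathbb{P}^1}(d_1))^{a_1+1})\times\mathbb{P}(H^0(\mathcal{O}_{\mathbb{P}^1}(d_2))^{a_2+1})\right)/\mathrm{PGL}(2)$. Incidence correspondence. $J_{d_1,d_2}=\{(C,\underline{s})\in\mathcal{M}_{d_1,d_2}\times U_A\mid C\subset V(s_1,\dots,s_m)\}$.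
   Formalization: ''Irreducible'' is understood so that the empty set counts as irreducible, because J can be empty: for X = P^3×P^2, A = (4 0; 0 3) and (d1,d2) = (0,1), a smooth plane cubic contains no line. When J is nonempty it is irreducible in the usual sense. *)

(* Defs.v *)
From HB Require Import structures.
From mathcomp Require Import all_boot all_order all_algebra.
From mathcomp Require Import boolp classical_sets cardinality reals.
From mathcomp Require Import complex mpoly.

Set Implicit Arguments.
Unset Strict Implicit.
Unset Printing Implicit Defensive.

Import GRing.Theory.
Local Open Scope ring_scope.
Local Open Scope classical_set_scope.

Definition vec (K : closedFieldType) (I : finType) := {ffun I -> K^o}.

(* Polynomial functions on K^I: the variable attached to i : I is the one of
   rank [enum_rank i]. *)
Definition peval (K : closedFieldType) (I : finType) (f : {mpoly K[#|I|]})
  (z : vec K I) : K := f.@[fun k => z (enum_val k)].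

Definition pvar (K : closedFieldType) (I : finType) (i : I) :
  {mpoly K[#|I|]} := 'X_(enum_rank i).

Definition pderiv (K : closedFieldType) (I : finType) (i : I)
  (f : {mpoly K[#|I|]}) : {mpoly K[#|I|]} := f^`M(enum_rank i).

(* A variety given by its closed points together with a quotient map onto it
   from a subset of an affine space K^coords: [rep z t] means that z is a
   system of (homogeneous) coordinates of the point t.  The Zariski topology of
   the variety is the quotient of the one of { z | exists t, rep z t }, itself
   seen as a subspace of K^coords. *)
Record coord_space (K : closedFieldType) := CoordSpace {
  points :> Type ;
  coords : finType ;
  rep : vec K coords -> points -> Prop }.

Arguments rep {K} c _ _.

Definition zclosed (K : closedFieldType) (T : coord_space K) (Z : set T) :=
  exists F : set {mpoly K[#|coords T|]},
    forall z t, rep T z t -> (Z t <-> forall f, F f -> peval f z = 0).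

Definition zopen (K : closedFieldType) (T : coord_space K) (W : set T) :=
  zclosed (~` W).

(* Irreducibility for the induced topology.  The empty set is irreducible in
   this sense; where it has to be excluded this is said separately. *)
Definition zirreducible (K : closedFieldType) (T : coord_space K)
    (A : set T) :=
  forall Z1 Z2 : set T, zclosed Z1 -> zclosed Z2 ->
    A `<=` Z1 `|` Z2 -> A `<=` Z1 \/ A `<=` Z2.

(* P(K^I), whose points are the lines of K^I.  As L has dimension 1,
   <[z]> = L forces z != 0. *)
Definition pspace (K : closedFieldType) (I : finType) : coord_space K :=
  @CoordSpace K {L : {vspace vec K I} | \dim L == 1%N} I
    (fun z L => <[z]>%VS = val L).

Definition lpart (K : closedFieldType) (I J : finType) (z : vec K (I + J)%type) :
  vec K I := [ffun i => z (inl i)].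

Definition rpart (K : closedFieldType) (I J : finType) (z : vec K (I + J)%type) :
  vec K J := [ffun j => z (inr j)].

Definition component (K : closedFieldType) (J : finType) (I : J -> finType)
    (z : vec K {j : J & I j}) (j : J) : vec K (I j) :=
  [ffun i => z (Tagged I i)].

(* Products of varieties.  All the quotient maps used below are quotients by
   algebraic groups (products of copies of the multiplicative group and of
   PGL(2)), hence universally open, so that the quotient topology below is the
   Zariski topology of the product variety (and not the product topology). *)
Definition prod_space (K : closedFieldType) (T1 T2 : coord_space K) :
    coord_space K :=
  @CoordSpace K (T1 * T2)%type (coords T1 + coords T2)%type
    (fun z t => rep T1 (lpart z) t.1 /\ rep T2 (rpart z) t.2).

Definition fam_space (K : closedFieldType) (J : finType)
    (T : J -> coord_space K) : coord_space K :=
  @CoordSpace K (forall j, T j) {j : J & coords (T j)}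
    (fun z t => forall j, rep (T j) (component z j) (t j)).

(* The monomials of degree d in n.+1 variables. *)
Definition mon (n d : nat) : finType :=
  {mu : 'X_{1..n.+1 < d.+1} | mdeg mu == d}.

(* P^a1 x P^a2 *)
Definition biproj (K : closedFieldType) (a1 a2 : nat) : coord_space K :=
  prod_space (pspace K 'I_a1.+1) (pspace K 'I_a2.+1).

(* The monomial basis of H^0(O_X(b1, b2)), so that this space is
   [vec K (bimon a1 a2 b1 b2)]. *)
Definition bimon (a1 a2 b1 b2 : nat) : finType := (mon a1 b1 * mon a2 b2)%type.

Definition biform (K : closedFieldType) (a1 a2 b1 b2 : nat)
    (s : vec K (bimon a1 a2 b1 b2)) :
    {mpoly K[#|('I_a1.+1 + 'I_a2.+1)%type : finType|]} :=
  \sum_(mu : bimon a1 a2 b1 b2)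
    (s mu : K) *: ((\prod_i pvar K (inl i) ^+ (val mu.1 : 'X_{1..a1.+1}) i) *
                   (\prod_i pvar K (inr i) ^+ (val mu.2 : 'X_{1..a2.+1}) i)).

(* The product over j of the spaces P(H^0(O_X(A 0 j, A 1 j))). *)
Definition section_space (K : closedFieldType) (a1 a2 m : nat)
    (A : 'M[nat]_(2, m)) : coord_space K :=
  fam_space (fun j : 'I_m => pspace K (bimon a1 a2 (A ord0 j) (A ord_max j))).

Definition zero_locus (K : closedFieldType) (a1 a2 m : nat)
    (A : 'M[nat]_(2, m)) (s : section_space K a1 a2 A) : set (biproj K a1 a2) :=
  [set q | forall z w, rep (biproj K a1 a2) z q ->
     rep (section_space K a1 a2 A) w s ->
     forall j, peval (biform (component w j)) z = 0].

Definition jacobian (K : closedFieldType) (a1 a2 m : nat)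
    (A : 'M[nat]_(2, m)) (w : vec K (coords (section_space K a1 a2 A)))
    (z : vec K (coords (biproj K a1 a2))) :
    'M[K]_(m, #|coords (biproj K a1 a2)|) :=
  \matrix_(j, k) peval (pderiv (enum_val k) (biform (component w j))) z.

(* V(s) is, as a scheme, a smooth complete intersection of codimension m
   (Jacobian criterion, on the product of the two affine cones). *)
Definition smooth_ci (K : closedFieldType) (a1 a2 m : nat)
    (A : 'M[nat]_(2, m)) (s : section_space K a1 a2 A) : Prop :=
  zero_locus s !=set0 /\
  forall q z w, zero_locus s q -> rep (biproj K a1 a2) z q ->
    rep (section_space K a1 a2 A) w s -> \rank (jacobian w z) = m.

Definition configuration_matrix (K : closedFieldType) (a1 a2 m : nat)
    (A : 'M[nat]_(2, m)) : Prop :=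
  [/\ (0 < m)%N /\ (m + 3 = a1 + a2)%N,
      forall j, exists i, A i j <> 0%N,
      (\sum_j A ord0 j = a1.+1)%N,
      (\sum_j A ord_max j = a2.+1)%N &
      exists W : set (section_space K a1 a2 A),
        [/\ zopen W, W !=set0 &
            forall s, W s -> smooth_ci s /\ zirreducible (zero_locus s)]].

(* An element al of H^0(O_{P^1}(d))^(a+1) and the polynomial map
   K^2 -> K^(a+1) it defines. *)
Definition binary_form (K : closedFieldType) (a d : nat)
    (al : vec K ('I_a.+1 * mon 1 d)%type) (i : 'I_a.+1) :
    {mpoly K[#|('I_2 : finType)|]} :=
  \sum_(mu : mon 1 d)
    (al (i, mu) : K) *: \prod_k pvar K k ^+ (val mu : 'X_{1..2}) k.

Definition binary_map (K : closedFieldType) (a d : nat)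
    (al : vec K ('I_a.+1 * mon 1 d)%type) (p : vec K 'I_2) : vec K 'I_a.+1 :=
  [ffun i => peval (binary_form al i) p].

Definition binary_diff (K : closedFieldType) (a d : nat)
    (al : vec K ('I_a.+1 * mon 1 d)%type) (p v : vec K 'I_2) : vec K 'I_a.+1 :=
  [ffun i => \sum_k peval (pderiv k (binary_form al i)) p * (v k : K)].

(* (al, be) defines a closed embedding of P^1 in P^a1 x P^a2: it has no base
   point, is injective on points, and on tangent vectors, the tangent space of
   P(V) at <[x]> being V / <[x]> up to a twist. *)
Definition embedding (K : closedFieldType) (a1 a2 d1 d2 : nat)
    (al : vec K ('I_a1.+1 * mon 1 d1)%type)
    (be : vec K ('I_a2.+1 * mon 1 d2)%type) : Prop :=
  [/\ forall p, p != 0 -> binary_map al p != 0 /\ binary_map be p != 0,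
      forall p q, p != 0 -> q != 0 ->
        <[binary_map al p]>%VS = <[binary_map al q]>%VS ->
        <[binary_map be p]>%VS = <[binary_map be q]>%VS ->
        <[p]>%VS = <[q]>%VS &
      forall p v, p != 0 ->
        binary_diff al p v \in <[binary_map al p]>%VS ->
        binary_diff be p v \in <[binary_map be p]>%VS ->
        v \in <[p]>%VS].

Definition curve_image (K : closedFieldType) (a1 a2 d1 d2 : nat)
    (al : vec K ('I_a1.+1 * mon 1 d1)%type)
    (be : vec K ('I_a2.+1 * mon 1 d2)%type) : set (biproj K a1 a2) :=
  [set q | exists p, [/\ p != 0, rep (pspace K 'I_a1.+1) (binary_map al p) q.1 &
                         rep (pspace K 'I_a2.+1) (binary_map be p) q.2]].

(* Since the parametrization is an isomorphism from P^1 onto C and has no base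
   point, the degrees d1, d2 of the forms are the degrees of O(1, 0)|_C and
   O(0, 1)|_C. *)
Definition parametrizes (K : closedFieldType) (a1 a2 d1 d2 : nat)
    (al : vec K ('I_a1.+1 * mon 1 d1)%type)
    (be : vec K ('I_a2.+1 * mon 1 d2)%type) (C : set (biproj K a1 a2)) : Prop :=
  embedding al be /\ C = curve_image al be.

(* The moduli space M_{d1,d2}: its points are the curves themselves, and its
   topology is the quotient one for (al, be) |-> C, whose fibres are the orbits
   of the reparametrizations and of the rescalings of al and be. *)
Definition curve_space (K : closedFieldType) (a1 a2 d1 d2 : nat) :
    coord_space K :=
  @CoordSpace K
    {C : set (biproj K a1 a2) | exists (al : vec K ('I_a1.+1 * mon 1 d1)%type)
       (be : vec K ('I_a2.+1 * mon 1 d2)%type), parametrizes al be C}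
    ('I_a1.+1 * mon 1 d1 + 'I_a2.+1 * mon 1 d2)%type
    (fun z C => parametrizes (lpart z) (rpart z) (sval C)).

Definition curve_set (K : closedFieldType) (a1 a2 d1 d2 : nat)
  (C : curve_space K a1 a2 d1 d2) : set (biproj K a1 a2) := sval C.

(* J_{d1,d2}.  It can be empty: for a1 = 3, a2 = 2 and the columns (4, 0),
   (0, 3), V(s) is the product of a K3 surface and a plane cubic, which contains
   no curve of bidegree (0, 1). *)
Definition incidence (K : closedFieldType) (a1 a2 d1 d2 m : nat)
    (A : 'M[nat]_(2, m)) :
    set (prod_space (curve_space K a1 a2 d1 d2) (section_space K a1 a2 A)) :=
  [set Cs | smooth_ci Cs.2 /\ curve_set Cs.1 `<=` zero_locus Cs.2].

Arguments incidence K a1 a2 d1 d2 {m} A _.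

(* Main.v *)
(* Write E(C) for the matrix of the linear conditions on w = (w_1, ..., w_m) expressing
   that the curve C lies on V(w): w_j vanishes at b_1j d_1 + b_2j d_2 + 1 points of C.
   As d_1, d_2 <= 1, products of linear forms separate these points, so E(C) always has
   full row rank, and Cramer's rule parametrizes its kernel polynomially in C.

   Irreducibility: two points of J are joined by a polynomial path inside
   { (C, w) | E(C) w = 0 }, and near a point where V(w) is smooth the path consists of
   smooth complete intersections, by compactness of projective space over C.

   Finiteness: the row count of E(C) and the Calabi-Yau condition make the dimension of
   { (C, w) | E(C) w = 0 } equal to that of the space of w.  On each of finitely many
   charts this set is the image of an affine space of the dimension of the target, and
   every coordinate of the source is then algebraic over the components of the map. *)

Require Import Defs.
From HB Require Import structures.
From mathcomp Require Import all_boot all_order all_algebra.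
From mathcomp Require Import boolp classical_sets cardinality reals.
From mathcomp Require Import complex mpoly.
From mathcomp Require Import ring lra zify.

Set Implicit Arguments.
Unset Strict Implicit.
Unset Printing Implicit Defensive.
Import Order.TTheory GRing.Theory Num.Theory.
Local Open Scope ring_scope.
Local Open Scope classical_set_scope.

(** * Algebras of functions, polynomial functions *)

(** Finiteness rests on counting instead of a theorem on fibre dimension: sufficiently many
    monomials in the components of a polynomial map and one source coordinate satisfy a linear
    relation, because their degrees leave too little room. This requires that the source have no
    more coordinates than the target, and parametrized curves have five too many: three from
    reparametrizing the line, two from scaling [al] and [be]. Fixing five coefficients at 0 or 1
    removes them; together with a choice of pivots for Cramer's rule this yields the finitely many
    charts. For irreducibility the obstacle is that pivots which are good at one end of the path may
    be bad at the other. Cramer's formula without division stays in the kernel even where its minor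
    vanishes, so one such term is taken for each end and the two are interpolated. The topology of
    the complex numbers enters through two properties, used to show that smoothness persists along a
    path. *)

Section FunAlgebra.
Variables (K : fieldType) (X : Type).

(** Polynomials in the parameter of a path, polynomials in the coordinates of a chart and functions
    with a limit all form such an algebra, so determinants, adjugates and Cramer's formula are
    treated once for the three. *)
Record fun_algebra (A : (X -> K) -> Prop) : Prop := FunAlgebra {
  fa_const : forall c, A (fun=> c);
  fa_add : forall f g, A f -> A g -> A (fun x => f x + g x);
  fa_mul : forall f g, A f -> A g -> A (fun x => f x * g x) }.

Variables (A : (X -> K) -> Prop) (hA : fun_algebra A).

Lemma fa_ext f g : A f -> (forall x, f x = g x) -> A g.
Proof. by move=> Af fg; have <- : f = g by apply/funext. Qed.

Lemma fa_sum (I : Type) (r : seq I) (P : pred I) (F : I -> X -> K) :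
  (forall i, A (F i)) -> A (fun x => \sum_(i <- r | P i) F i x).
Proof.
move=> AF; elim: r => [|i r IHr].
  by apply: (fa_ext (fa_const hA 0)) => x; rewrite big_nil.
case Pi: (P i).
  by apply: (fa_ext (fa_add hA (AF i) IHr)) => x; rewrite big_cons Pi.
by apply: (fa_ext IHr) => x; rewrite big_cons Pi.
Qed.

Lemma fa_prod (I : Type) (r : seq I) (P : pred I) (F : I -> X -> K) :
  (forall i, A (F i)) -> A (fun x => \prod_(i <- r | P i) F i x).
Proof.
move=> AF; elim: r => [|i r IHr].
  by apply: (fa_ext (fa_const hA 1)) => x; rewrite big_nil.
case Pi: (P i).
  by apply: (fa_ext (fa_mul hA (AF i) IHr)) => x; rewrite big_cons Pi.
by apply: (fa_ext IHr) => x; rewrite big_cons Pi.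
Qed.

Lemma fa_exp f n : A f -> A (fun x => f x ^+ n).
Proof.
move=> Af; elim: n => [|n IHn]; first by apply: (fa_ext (fa_const hA 1)).
by apply: (fa_ext (fa_mul hA Af IHn)) => x; rewrite exprS.
Qed.

Lemma fa_opp f : A f -> A (fun x => - f x).
Proof.
move=> Af; apply: (fa_ext (fa_mul hA (fa_const hA (-1)) Af)) => x.
by rewrite mulN1r.
Qed.

Lemma fa_sub f g : A f -> A g -> A (fun x => f x - g x).
Proof. by move=> Af Ag; apply: (fa_add hA Af); apply: fa_opp. Qed.

Lemma fa_meval n (p : {mpoly K[n]}) (g : 'I_n -> X -> K) :
  (forall i, A (g i)) -> A (fun x => p.@[fun i => g i x]).
Proof.
move=> Ag; apply: (@fa_ext (fun x => \sum_(m <- msupp p)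
    p@_m * \prod_i (g i x) ^+ (m i))) => [|x]; last by rewrite mevalE.
apply: fa_sum => m; apply: (fa_mul hA (fa_const hA _)).
by apply: fa_prod => i; apply: fa_exp.
Qed.

Lemma fa_det n (M : X -> 'M[K]_n) :
  (forall i j, A (fun x => M x i j)) -> A (fun x => \det (M x)).
Proof.
move=> AM; apply: fa_sum => s; apply: (fa_mul hA (fa_const hA _)).
by apply: fa_prod.
Qed.

Lemma fa_adj n (M : X -> 'M[K]_n) :
  (forall i j, A (fun x => M x i j)) -> forall i j, A (fun x => (\adj (M x)) i j).
Proof.
move=> AM i j.
apply: (@fa_ext (fun x => cofactor (M x) j i)) => [|x]; last by rewrite mxE.
apply: (fa_mul hA (fa_const hA _)); apply: fa_det => k l.
by apply: (fa_ext (AM (lift j k) (lift i l))) => x; rewrite !mxE.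
Qed.

Lemma fa_mulmx m n p (M : X -> 'M[K]_(m, n)) (N : X -> 'M[K]_(n, p)) :
  (forall i j, A (fun x => M x i j)) -> (forall i j, A (fun x => N x i j)) ->
  forall i j, A (fun x => (M x *m N x) i j).
Proof.
move=> AM AN i j.
apply: (@fa_ext (fun x => \sum_k M x i k * N x k j)) => [|x]; last by rewrite mxE.
by apply: fa_sum => k; apply: (fa_mul hA).
Qed.

End FunAlgebra.

(** * Polynomial functions of one and of several variables *)

Definition is_poly (K : fieldType) (h : K -> K) :=
  exists p : {poly K}, forall t, h t = p.[t].

Lemma is_poly_algebra (K : fieldType) : fun_algebra (@is_poly K).
Proof.
split=> [c|f g [p fp] [q gq]|f g [p fp] [q gq]].
- by exists c%:P => t; rewrite hornerC.
- by exists (p + q) => t; rewrite hornerD fp gq.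
- by exists (p * q) => t; rewrite hornerM fp gq.
Qed.

Lemma is_poly_id (K : fieldType) : is_poly (fun t : K => t).
Proof. by exists 'X => t; rewrite hornerX. Qed.

(** The points e / (i + 2) for i < [size p] are distinct and outnumber the possible roots of p; the
    shift by 2 keeps them strictly below e. *)
Lemma poly_nonroot (K : numFieldType) (p : {poly K}) (e : K) :
  p != 0 -> 0 < e -> exists t, [/\ 0 < t, t < e & p.[t] != 0].
Proof.
move=> p0 e0; apply: contrapT => H.
pose t (i : nat) : K := e / (i.+2)%:R.
have t_inj : injective t.
  move=> i j /(mulfI (lt0r_neq0 e0)) /invr_inj /eqP.
  by rewrite eqr_nat => /eqP [].
suff roots : all (root p) [seq t i | i <- iota 0 (size p)].
  have := max_poly_roots p0 roots.
  by rewrite map_inj_uniq // iota_uniq size_map size_iota ltnn => /(_ isT).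
apply/allP => x /mapP [i _ ->]; apply: contrapT => /negP ti; apply: H; exists (t i); split=> //.
  by rewrite divr_gt0 // ltr0n.
by rewrite ltr_pdivrMr ?ltr0n // ltr_pMr // ltr1n.
Qed.

Definition is_mpoly (K : fieldType) n (h : ('I_n -> K) -> K) :=
  exists p : {mpoly K[n]}, forall x, h x = p.@[x].

Lemma is_mpoly_algebra (K : fieldType) n : fun_algebra (@is_mpoly K n).
Proof.
split=> [c|f g [p fp] [q gq]|f g [p fp] [q gq]].
- by exists c%:MP => t; rewrite mevalC.
- by exists (p + q) => t; rewrite mevalD fp gq.
- by exists (p * q) => t; rewrite mevalM fp gq.
Qed.

Lemma is_mpoly_var (K : fieldType) n i : is_mpoly (fun x : 'I_n -> K => x i).
Proof. by exists 'X_i => t; rewrite mevalXU. Qed.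

Lemma poly_eval0 (K : numFieldType) (p : {poly K}) :
  (forall t, p.[t] = 0) -> p = 0.
Proof.
move=> H; apply: contrapT => /eqP p0.
by have [t [_ _]] := poly_nonroot p0 (@ltr01 K); rewrite H eqxx.
Qed.

Lemma widen_lift_max n (i : 'I_n) : widen_ord (leqnSn n) i = lift ord_max i.
Proof. by apply: ord_inj; rewrite lift_max. Qed.

Definition mrestr n (m : 'X_{1..n.+1}) : 'X_{1..n} :=
  [multinom m (widen_ord (leqnSn n) i) | i < n].

Lemma muni_coef (K : fieldType) n (p : {mpoly K[n.+1]}) d :
  (muni p)`_d = \sum_(m <- msupp p | m ord_max == d) p@_m *: 'X_[mrestr m].
Proof.
rewrite muniE coef_sum [RHS]big_mkcond /=; apply: eq_bigr => m _.
rewrite coefZ coefXn eq_sym; case: eqP => _; rewrite ?mulr1 ?mulr0 //.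
Qed.

(** Induction on the number of variables: once all but the last are fixed, p becomes a univariate
    polynomial vanishing everywhere, so each coefficient of [muni p] vanishes at every point. *)
Lemma mpoly_eval0 (K : numFieldType) n (p : {mpoly K[n]}) :
  (forall v, p.@[v] = 0) -> p = 0.
Proof.
elim: n p => [|n IHn] p H.
  by rewrite [p]nvar0_mpolyC; have := H (fun=> 0);
     rewrite {1}[p]nvar0_mpolyC mevalC => ->.
have mu0 d : (muni p)`_d = 0.
  apply: IHn => v.
  have : map_poly (meval v) (muni p) = 0.
    apply: poly_eval0 => t.
    pose w (i : 'I_n.+1) := if unlift ord_max i is Some j then v j else t.
    rewrite -[RHS](H w) muniE raddf_sum /= horner_sum mevalE.
    apply: eq_bigr => m _.
    rewrite [X in X.[t]](_ : _ =
      (p@_m * \prod_(i < n) v i ^+ (m (widen_ord (leqnSn n) i)))%:P * 'X^(m ord_max)).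
      rewrite hornerM hornerC hornerXn -mulrA; congr (_ * _).
      rewrite big_ord_recr /=; congr (_ * _); last by rewrite /w unlift_none.
      apply: eq_bigr => i _; congr (_ ^+ _).
      by rewrite /w widen_lift_max liftK.
    apply/polyP => k; rewrite coef_map /= coefZ coefXn coefCM coefXn.
    case: eqP => _; last by rewrite !mulr0 raddf0.
    by rewrite !mulr1 mevalZ mevalX; congr (_ * _); apply: eq_bigr => i _; rewrite mnmE.
  by move/(congr1 (fun q : {poly K} => q`_d)); rewrite coef_map coef0.
apply/mpolyP => m; rewrite mcoeff0; apply/eqP; rewrite mcoeff_eq0.
apply/negP => ms; have := mu0 (m ord_max).
rewrite muni_coef big_mkcond => /(congr1 (mcoeff (mrestr m))).
rewrite raddf_sum /= mcoeff0 (bigD1_seq m) //= ?msupp_uniq // eqxx.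
rewrite mcoeffZ mcoeffX eqxx mulr1 big1 ?addr0 => [/eqP|m' m'n].
  by rewrite mcoeff_eq0 ms.
case: eqP => m'm; last by rewrite mcoeff0.
rewrite mcoeffZ mcoeffX; case: eqP => [e|]; rewrite ?mulr0 //.
case/negP: m'n; apply/eqP/mnmP => i.
case: (unliftP ord_max i) => [j|] -> //.
by move/mnmP/(_ j): e; rewrite !mnmE !widen_lift_max.
Qed.

Lemma mpoly_nonroot (K : numFieldType) n (p : {mpoly K[n]}) :
  p != 0 -> exists v, p.@[v] != 0.
Proof.
move=> p0; apply: contrapT => H; case/eqP: p0; apply: mpoly_eval0 => v.
by apply: contrapT => /eqP pv; apply: H; exists v.
Qed.

(** * Algebraic dependence and finite fibres *)

Lemma msize_mul_le (K : fieldType) n (p q : {mpoly K[n]}) a b :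
  (msize p <= a.+1)%N -> (msize q <= b.+1)%N -> (msize (p * q) <= (a + b).+1)%N.
Proof.
have [->|p0] := eqVneq p 0; first by rewrite mul0r msize0.
have [->|q0] := eqVneq q 0; first by rewrite mulr0 msize0.
rewrite msizeM //; move: (msize p) (msize q) => i j; lia.
Qed.

Lemma msize_exp_le (K : fieldType) n (p : {mpoly K[n]}) a k :
  (msize p <= a.+1)%N -> (msize (p ^+ k) <= (k * a).+1)%N.
Proof.
move=> pa; elim: k => [|k IHk]; first by rewrite expr0 msize1.
by rewrite exprS mulSn; apply: msize_mul_le.
Qed.

Lemma msize_prod_le (K : fieldType) n (I : finType) (p : I -> {mpoly K[n]}) a :
  (forall i, msize (p i) <= a.+1)%N -> (msize (\prod_i p i) <= (#|I| * a).+1)%N.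
Proof.
move=> pa; rewrite cardE -[index_enum I]enumT.
elim: (enum I) => [|i r IHr] /=; first by rewrite big_nil msize1.
by rewrite big_cons mulSn; apply: msize_mul_le.
Qed.

Lemma card_bmultinom_le n D : (#|{: 'X_{1..n < D}}| <= D ^ n)%N.
Proof.
have H (m : 'X_{1..n < D}) (i : 'I_n) : (m i < D)%N.
  apply: leq_ltn_trans (bmdeg m); rewrite mdegE (bigD1 i) //=; exact: leq_addr.
pose f (m : 'X_{1..n < D}) : {ffun 'I_n -> 'I_D} := [ffun i => Ordinal (H m i)].
have f_inj : injective f.
  move=> m1 m2 /ffunP e; apply/val_inj/mnmP => i.
  by have := e i; rewrite !ffunE => /(congr1 val).
by rewrite -[X in (X ^ _)%N]card_ord -[X in (_ ^ X)%N](card_ord n) -card_ffun;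
   apply: leq_card f_inj.
Qed.

Lemma linear_dependence (K : fieldType) (I J : finType) (M : I -> J -> K) :
  (#|J| < #|I|)%N ->
  exists c : I -> K, (exists i, c i != 0) /\ forall j, \sum_i c i * M i j = 0.
Proof.
move=> JI.
pose A : 'M[K]_(#|I|, #|J|) := \matrix_(i, j) M (enum_val i) (enum_val j).
have : kermx A != 0.
  rewrite -mxrank_eq0 mxrank_ker subn_eq0 -ltnNge.
  exact: leq_ltn_trans (rank_leq_col A) JI.
case/rowV0Pn => u /sub_kermxP uA /rV0Pn [i ui].
exists (fun a => u 0 (enum_rank a)); split.
  by exists (enum_val i); rewrite enum_valK.
move=> j; have := congr1 (fun B : 'rV_#|J| => B 0 (enum_rank j)) uA.
rewrite !mxE => uAj; rewrite -[RHS]uAj.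
rewrite (reindex_onto enum_rank enum_val) => [|k _]; last exact: enum_valK.
rewrite [RHS](eq_bigl xpredT) => [|k]; last by rewrite enum_rankK eqxx.
by apply: eq_bigr => k _; rewrite !mxE !enum_rankK.
Qed.

Lemma leq_exp2 a b n : (a <= b)%N -> (a ^ n <= b ^ n)%N.
Proof. by move=> ab; elim: n => // n IHn; rewrite !expnS leq_mul. Qed.

(** The right side counts the monomials in N + 1 functions with all exponents below B. If these
    functions have degree at most d in n variables, the left side bounds the number of monomials
    that can occur in the results. The right side wins for large B because N + 1 > n. *)
Lemma box_count n N d : (n <= N)%N -> exists2 B : nat, (0 < B)%N &
  ((N.+1 * (B * d)).+1 ^ n < B ^ N * B)%N.
Proof.
move=> nN; pose c := (N.+1 * d).+1; exists (c ^ n).+1 => //; set B := (c ^ n).+1.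
have /leq_ltn_trans -> // : ((N.+1 * (B * d)).+1 ^ n <= (B * c) ^ n)%N.
  apply: leq_exp2; rewrite /c mulnS; rewrite -addn1 addnC; apply: leq_add => //.
  by rewrite mulnCA.
rewrite expnMn.
apply: (@leq_trans (B ^ n * B)); first by rewrite ltn_pmul2l ?expn_gt0.
by rewrite leq_pmul2r // leq_pexp2l.
Qed.

(* More polynomials than variables are algebraically dependent, so g is a root of
   a nonzero polynomial whose coefficients are polynomials in the F c. *)
Lemma finite_fibres (K : numClosedFieldType) n N (F : 'I_N -> ('I_n -> K) -> K)
    (g : ('I_n -> K) -> K) :
  (n <= N)%N -> (forall c, is_mpoly (F c)) -> is_mpoly g ->
  exists2 h : {mpoly K[N]}, h != 0 & forall v, h.@[v] != 0 ->
    exists l : seq K, forall x, (forall c, F c x = v c) -> g x \in l.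
Proof.
move=> nN /fin_all_exists [p Fp] [q gq].
pose d := (\sum_c msize (p c) + msize q)%N.
have pd c : (msize (p c) <= d.+1)%N.
  by rewrite /d (bigD1 c) //= -addnA; apply: leqW; apply: leq_addr.
have qd : (msize q <= d.+1)%N by apply: leqW; apply: leq_addl.
have [B B0 cB] := box_count d nN.
pose I : finType := ({ffun 'I_N -> 'I_B} * 'I_B)%type.
pose D := (N.+1 * (B * d)).+1.
pose J : finType := 'X_{1..n < D}.
pose mn (a : I) := \prod_c p c ^+ a.1 c * q ^+ a.2.
have mnD a : (msize (mn a) <= D)%N.
  rewrite /D mulSn addnC; apply: msize_mul_le.
    rewrite -[X in (X * _)%N](card_ord N); apply: msize_prod_le => c.
    apply: leq_trans (msize_exp_le _ (pd c)) _.
    by rewrite ltnS leq_mul2r (ltnW (ltn_ord _)) orbT.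
  apply: leq_trans (msize_exp_le _ qd) _.
  by rewrite ltnS leq_mul2r (ltnW (ltn_ord _)) orbT.
have JI : (#|J| < #|I|)%N.
  rewrite card_prod card_ffun !card_ord.
  exact: leq_ltn_trans (card_bmultinom_le _ _) cB.
have [c [[[al0 k0] c0] cJ]] := linear_dependence (fun a (m : J) => (mn a)@_m) JI.
have rel : \sum_a c a *: mn a = 0.
  apply/mpolyP => m; rewrite mcoeff0 raddf_sum /=.
  have [mD|mD] := ltnP (mdeg m) D.
    rewrite -[RHS](cJ (BMultinom mD)); apply: eq_bigr => a _; exact: mcoeffZ.
  rewrite big1 // => a _; rewrite mcoeffZ [X in _ * X](_ : _ = 0) ?mulr0 //.
  by apply/eqP; rewrite mcoeff_eq0; apply: msize_mdeg_ge; apply: leq_trans (mnD a) mD.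
pose mm (al : {ffun 'I_N -> 'I_B}) := [multinom (al i : nat) | i < N].
have mm_inj : injective mm.
  move=> a b /mnmP e; apply/ffunP => i; apply: val_inj.
  by have := e i; rewrite !mnmE.
(* The relation [rel] is grouped by powers k of g. The power [k0] occurs with a nonzero coefficient,
   so [h k0] is nonzero, and where it does not vanish the relation specializes to a nonzero
   polynomial [Q] with root g x. *)
pose h k : {mpoly K[N]} := \sum_al c (al, k) *: 'X_[mm al].
exists (h k0).
  apply/eqP => /(congr1 (mcoeff (mm al0))); rewrite mcoeff0 raddf_sum /=.
  rewrite (bigD1 al0) //= mcoeffZ mcoeffX eqxx mulr1 big1 ?addr0 => [/eqP|al aln].
    exact/negP.
  by rewrite mcoeffZ mcoeffX (inj_eq mm_inj) (negbTE aln) mulr0.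
move=> v hv; pose Q : {poly K} := \sum_(k < B) (h k).@[v] *: 'X^k.
have Q0 : Q != 0.
  apply/eqP => /(congr1 (fun r : {poly K} => r`_k0)); rewrite coef0 coef_sum.
  rewrite (bigD1 k0) //= coefZ coefXn eqxx mulr1 big1 ?addr0 => [/eqP|k kn].
    exact/negP.
  by rewrite coefZ coefXn (inj_eq val_inj) eq_sym (negbTE kn) mulr0.
have [r Qr] := closed_field_poly_normal Q.
exists r => x Fx; suff : root Q (g x).
  by rewrite Qr rootZ ?lead_coef_eq0 // root_prod_XsubC.
have := congr1 (meval x) rel; rewrite meval0 raddf_sum /= => rel0.
rewrite /root horner_sum -[X in _ == X]rel0; apply/eqP.
have -> : \sum_i (c i *: mn i).@[x] = \sum_al 
    \sum_k (c (al, k) *: mn (al, k)).@[x].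
  by rewrite pair_bigA; apply: eq_bigr => -[].
rewrite exchange_big /=; apply: eq_bigr => k _.
rewrite hornerZ hornerXn raddf_sum /= mulr_suml; apply: eq_bigr => al _.
rewrite !mevalZ /mn mevalM mevalX -mulrA; congr (_ * (_ * _)).
  rewrite rmorph_prod; apply: eq_bigr => i _.
  by rewrite mnmE rmorphXn /= -Fp Fx.
by rewrite rmorphXn /= -gq.
Qed.

(** * Cramer's rule and bihomogeneous forms *)

(** Matrix of the inclusion of the pivot coordinates; multiplying E by it on the right selects the
    columns f of E. *)
Definition pivot_ext (K : fieldType) r s (f : 'I_r -> 'I_s) : 'M[K]_(s, r) :=
  \matrix_(c, k) (c == f k)%:R.

Definition pivot_minor (K : fieldType) r s (E : 'M[K]_(r, s)) (f : 'I_r -> 'I_s) : 'M[K]_r :=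
  E *m pivot_ext K f.

(* Cramer's rule: when the minor of E on the columns f is invertible, the column
   vectors killed by E are parametrized by their entries off f. *)
Definition kernel_param (K : fieldType) r s (E : 'M[K]_(r, s))
    (f : 'I_r -> 'I_s) (u : 'cV[K]_s) :=
  \det (pivot_minor E f) *: u - pivot_ext K f *m (\adj (pivot_minor E f) *m (E *m u)).

Section KernelParam.
Variables (K : fieldType) (r s : nat) (E : 'M[K]_(r, s)) (f : 'I_r -> 'I_s).

(** The identity M adj(M) = det(M) involves no inverse, so the equation persists at those parameters
    of a path where the minor vanishes. *)
Lemma mul_kernel_param u : E *m kernel_param E f u = 0.
Proof.
rewrite /kernel_param mulmxBr -scalemxAr mulmxA mulmxA -/(pivot_minor E f).
by rewrite mul_mx_adj mul_scalar_mx subrr.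
Qed.

Lemma kernel_param_ker u : E *m u = 0 ->
  kernel_param E f u = \det (pivot_minor E f) *: u.
Proof. by move=> Eu; rewrite /kernel_param Eu !mulmx0 subr0. Qed.

(** The entries of u at the pivots do not influence the result. They can be set to 0, which saves
    one coordinate for each row of E. *)
Lemma kernel_param_pivot u a :
  kernel_param E f (u - pivot_ext K f *m a) = kernel_param E f u.
Proof.
rewrite /kernel_param [E *m (_ - _)]mulmxBr [E *m (_ *m a)]mulmxA -/(pivot_minor E f).
rewrite [\adj _ *m (_ - _)]mulmxBr [\adj _ *m (_ *m a)]mulmxA mul_adj_mx mul_scalar_mx.
rewrite [pivot_ext K f *m (_ - _)]mulmxBr -scalemxAr scalerBr opprB.
by rewrite addrA subrK.
Qed.

Lemma pivot_ext_mul (a : 'cV[K]_r) : injective f ->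
  (forall k, (pivot_ext K f *m a) (f k) 0 = a k 0) /\
  (forall c, c \notin codom f -> (pivot_ext K f *m a) c 0 = 0).
Proof.
move=> f_inj; split=> [k|c cf]; rewrite mxE.
  rewrite (bigD1 k) //= big1 => [|j jk]; rewrite !mxE; first by rewrite eqxx mul1r addr0.
  by rewrite (inj_eq f_inj) eq_sym (negbTE jk) mul0r.
rewrite big1 // => k _; rewrite mxE; case: eqP => [ck|]; rewrite ?mul0r //.
by case/negP: cf; rewrite ck codom_f.
Qed.

Lemma row_free_pivot : row_free E ->
  exists2 g : 'I_r -> 'I_s, injective g & \det (pivot_minor E g) != 0.
Proof.
rewrite /row_free -mxrank_tr -/(row_full E^T) => fE.
exists (fullrankfun fE); first exact: fullrankfun_inj.
rewrite -unitfE -unitmxE -unitmx_tr.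
suff -> : (pivot_minor E (fullrankfun fE))^T = rowsub (fullrankfun fE) E^T.
  exact: fullrowsub_unit.
apply/matrixP => i j; rewrite !mxE (bigD1 (fullrankfun fE i)) //= big1 => [|k kf].
  by rewrite !mxE eqxx mulr1 addr0.
by rewrite !mxE (negbTE kf) mulr0.
Qed.

End KernelParam.

Lemma fa_kernel_param (K : fieldType) X (A : (X -> K) -> Prop) r s
    (E : X -> 'M[K]_(r, s)) f (u : X -> 'cV[K]_s) : fun_algebra A ->
  (forall i j, A (fun x => E x i j)) -> (forall i j, A (fun x => u x i j)) ->
  A (fun x => \det (pivot_minor (E x) f)) /\
  forall i j, A (fun x => kernel_param (E x) f (u x) i j).
Proof.
move=> hA AE Au.
have AP i j : A (fun x => (pivot_minor (E x) f) i j).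
  by apply: (fa_mulmx hA AE) => *; apply: (fa_const hA).
have Ad : A (fun x => \det (pivot_minor (E x) f)) by apply: (fa_det hA).
split=> // i j; pose Q : X -> 'M[K]_(s, r) := fun=> pivot_ext K f.
apply: (@fa_ext _ _ _ (fun x => \det (pivot_minor (E x) f) * u x i j -
   (Q x *m (\adj (pivot_minor (E x) f) *m (E x *m u x))) i j)) => [|x]; last first.
  by rewrite !mxE.
apply: (fa_sub hA); first exact: (fa_mul hA).
apply: (fa_mulmx hA) => [k l|]; first exact: (fa_const hA).
apply: (fa_mulmx hA); first exact: (fa_adj hA).
exact: (fa_mulmx hA).
Qed.

(** * Points of projective spaces and bihomogeneous forms *)

Section Forms.
Variable K : numClosedFieldType.

Lemma line_eq (I : finType) (u v : vec K I) :
  <[u]>%VS = <[v]>%VS -> exists2 c : K, c != 0 & v = c *: u.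
Proof.
move=> uv; have [v0|v0] := eqVneq v 0.
  exists 1; first exact: oner_neq0.
  have := dim_vline u; rewrite uv v0 dim_vline eqxx scale1r.
  by case: (eqVneq u 0).
have /vlineP [c vc] : v \in <[u]>%VS by rewrite uv memv_line.
by exists c => //; apply: contraNneq v0 => c0; rewrite vc c0 scale0r.
Qed.

Lemma line_scale (I : finType) (u : vec K I) (c : K) : c != 0 ->
  <[c *: u]>%VS = <[u]>%VS.
Proof.
move=> c0; apply/eqP; rewrite eqEsubv -!memvE memvZ ?memv_line //=.
by rewrite -[X in X \in _](scalerK c0) memvZ ?memv_line.
Qed.

Lemma vec_scaleE (I : finType) (u : vec K I) (c : K) i : (c *: u) i = c * (u i : K) :> K.
Proof. by rewrite ffunE. Qed.

Lemma vec_neq0P (I : finType) (u : vec K I) : reflect (exists i, u i != 0) (u != 0).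
Proof.
apply: (iffP idP) => [u0|[i ui]]; last by apply: contraNneq ui => ->; rewrite ffunE.
apply: contrapT => H; case/eqP: u0; apply/ffunP => i; rewrite ffunE.
by apply: contrapT => /eqP ui; apply: H; exists i.
Qed.

Definition ppoint (I : finType) (u : vec K I) (u0 : u != 0) : pspace K I :=
  exist (fun L : {vspace vec K I} => \dim L == 1%N) <[u]>%VS
    (introT eqP (etrans (dim_vline u) (congr1 nat_of_bool u0))).

Lemma rep_neq0 (I : finType) (u : vec K I) (L : pspace K I) :
  rep (pspace K I) u L -> u != 0.
Proof. by case: L => L /= dL uL; apply: contraTneq dL => u0; rewrite -uL u0 dim_vline eqxx. Qed.

Lemma rep_inj (I : finType) (u v : vec K I) (L : pspace K I) :
  rep (pspace K I) u L -> rep (pspace K I) v L -> exists2 c : K, c != 0 & v = c *: u.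
Proof. by move=> /= uL vL; apply: line_eq; rewrite uL. Qed.

Lemma mon_mdeg n d (mu : mon n d) : mdeg (val mu) = d.
Proof. by apply/eqP; case: mu. Qed.

Definition xmono n d (mu : mon n d) (x : 'I_n.+1 -> K) := \prod_i x i ^+ (val mu) i.

Lemma xmono_scale n d (mu : mon n d) (x y : 'I_n.+1 -> K) c :
  (forall i, y i = c * x i) -> xmono mu y = c ^+ d * xmono mu x.
Proof.
move=> xy; rewrite -[X in _ ^+ X](mon_mdeg mu) mdegE /xmono -prodrXr -big_split /=.
by apply: eq_bigr => i _; rewrite xy exprMn.
Qed.

Definition bimono a1 a2 b1 b2 (mu : bimon a1 a2 b1 b2) (x : 'I_a1.+1 -> K)
  (y : 'I_a2.+1 -> K) := xmono mu.1 x * xmono mu.2 y.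

Lemma peval_biform a1 a2 b1 b2 (s : vec K (bimon a1 a2 b1 b2))
    (z : vec K ('I_a1.+1 + 'I_a2.+1)%type) :
  peval (biform s) z =
  \sum_mu (s mu : K) * bimono mu (fun i => z (inl i)) (fun i => z (inr i)).
Proof.
rewrite /peval /biform raddf_sum /=; apply: eq_bigr => mu _.
rewrite mevalZ mevalM !rmorph_prod /=; congr (_ * (_ * _)); apply: eq_bigr => i _;
  by rewrite rmorphXn /= /pvar mevalXU enum_rankK.
Qed.

End Forms.

(** * Binary forms of degree at most one *)

Section BinaryMaps.
Variable K : numClosedFieldType.

Definition nondeg a d (al : vec K ('I_a.+1 * mon 1 d)%type) :=
  forall p, p != 0 -> binary_map al p != 0.

Lemma vec_subE (I : finType) (u v : vec K I) i : (u - v) i = u i - v i.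
Proof. by rewrite !ffunE. Qed.

Lemma exists_vec2 : exists p : vec K 'I_2, p != 0.
Proof.
pose p : vec K 'I_2 := [ffun=> 1].
by exists p; apply/vec_neq0P; exists ord0; rewrite ffunE oner_neq0.
Qed.

Lemma binary_mapE a d (al : vec K ('I_a.+1 * mon 1 d)%type) p i :
  binary_map al p i = \sum_(mu : mon 1 d) (al (i, mu) : K) * xmono mu p.
Proof.
rewrite ffunE /peval /binary_form raddf_sum /=; apply: eq_bigr => mu _.
rewrite mevalZ rmorph_prod /=; congr (_ * _); apply: eq_bigr => k _.
by rewrite rmorphXn /= mevalXU enum_rankK.
Qed.

Lemma binary_map_scale a d (al : vec K ('I_a.+1 * mon 1 d)%type) (p : vec K 'I_2) (c : K) :
  binary_map al (c *: p) = c ^+ d *: binary_map al p.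
Proof.
apply/ffunP => i; rewrite vec_scaleE !binary_mapE mulr_sumr; apply: eq_bigr => mu _.
have -> : xmono mu (c *: p) = c ^+ d * xmono mu p.
  by apply: xmono_scale => k; rewrite vec_scaleE.
by rewrite mulrCA.
Qed.

Lemma mon_bound n (m : 'X_{1..n}) d : mdeg m = d -> (mdeg m < d.+1)%N.
Proof. by move=> ->. Qed.

Definition mon_of n d (m : 'X_{1..n.+1}) (e : mdeg m = d) : mon n d :=
  exist (fun mu : 'X_{1..n.+1 < d.+1} => mdeg mu == d) (BMultinom (mon_bound e))
    (introT eqP e).

Definition mon0 n : mon n 0 := mon_of (@mdeg0 n.+1).

Definition mon1 n (k : 'I_n.+1) : mon n 1 := mon_of (mdeg1 k).

Lemma mon0_unique n (mu : mon n 0) : mu = mon0 n.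
Proof.
apply: val_inj; apply: val_inj; apply/mnmP => i /=.
by have /eqP := mon_mdeg mu; rewrite mdeg_eq0 => /eqP ->.
Qed.

Lemma mon1_bij n : bijective (@mon1 n).
Proof.
apply: inj_card_bij.
  move=> i j e; have /= := congr1 (fun mu : mon n 1 => (val mu : 'X_{1..n.+1}) j) e.
  by rewrite !mnm1E eqxx; case: eqP => // ->.
have H (mu : mon n 1) : exists i, mu = mon1 i.
  have /eqP /mdeg1P [i /eqP e] := mon_mdeg mu.
  by exists i; apply: val_inj; apply: val_inj; rewrite /= e.
have /fin_all_exists [g gP] := H.
by apply: (leq_card g) => x y e; rewrite (gP x) (gP y) e.
Qed.

Lemma sum_mon0 n (F : mon n 0 -> K) : \sum_mu F mu = F (mon0 n).
Proof. by rewrite (big_pred1 (mon0 n)) // => mu /=; rewrite [mu]mon0_unique eqxx. Qed.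

Lemma sum_mon1 n (F : mon n 1 -> K) : \sum_mu F mu = \sum_k F (mon1 k).
Proof. by rewrite (reindex (@mon1 n)) //; apply: onW_bij; apply: mon1_bij. Qed.

Lemma card_mon0 n : #|mon n 0| = 1%N.
Proof. by apply/eqP/fintype1P; exists (mon0 n) => mu; apply: mon0_unique. Qed.

Lemma card_mon1 n : #|mon n 1| = n.+1.
Proof. by rewrite -(bij_eq_card (mon1_bij n)) card_ord. Qed.

Lemma xmono_mon0 n (x : 'I_n.+1 -> K) : xmono (mon0 n) x = 1.
Proof. by rewrite /xmono big1 // => i _; rewrite mnm0E expr0. Qed.

Lemma xmono_mon1 n k (x : 'I_n.+1 -> K) : xmono (mon1 k) x = x k.
Proof.
rewrite /xmono (bigD1 k) //= mnm1E eqxx big1 ?mulr1 ?expr1 // => i ik.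
by rewrite mnm1E eq_sym (negbTE ik) expr0.
Qed.

Lemma binary_map0E a (al : vec K ('I_a.+1 * mon 1 0)%type) p i :
  binary_map al p i = al (i, mon0 1).
Proof. by rewrite binary_mapE sum_mon0 xmono_mon0 mulr1. Qed.

Lemma binary_map1E a (al : vec K ('I_a.+1 * mon 1 1)%type) p i :
  binary_map al p i = \sum_k (al (i, mon1 k) : K) * (p k : K).
Proof. by rewrite binary_mapE sum_mon1; apply: eq_bigr => k _; rewrite xmono_mon1. Qed.

Lemma binary_map1_linear a (al : vec K ('I_a.+1 * mon 1 1)%type) (c : K) (p q : vec K 'I_2) :
  binary_map al (c *: p - q) = c *: binary_map al p - binary_map al q.
Proof.
apply/ffunP => i; rewrite vec_subE vec_scaleE !binary_map1E.
rewrite mulr_sumr -sumrB; apply: eq_bigr => k _.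
by rewrite vec_subE vec_scaleE mulrBr mulrCA.
Qed.

Lemma nondeg1_inj a (al : vec K ('I_a.+1 * mon 1 1)%type) (c : K) (p q : vec K 'I_2) :
  nondeg al -> binary_map al q = c *: binary_map al p -> q = c *: p.
Proof.
move=> nd qp; apply/esym/eqP; rewrite -subr_eq0; apply: contraT => /nd.
by rewrite binary_map1_linear qp subrr eqxx.
Qed.

Lemma nondeg1_line a (al : vec K ('I_a.+1 * mon 1 1)%type) (p q : vec K 'I_2) :
  nondeg al -> <[binary_map al p]>%VS = <[binary_map al q]>%VS -> <[p]>%VS = <[q]>%VS.
Proof.
by move=> nd /line_eq [c c0 /(nondeg1_inj nd) ->]; rewrite line_scale.
Qed.

Lemma binary_form1E a (al : vec K ('I_a.+1 * mon 1 1)%type) i :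
  binary_form al i = \sum_k (al (i, mon1 k) : K) *: pvar K k.
Proof.
rewrite /binary_form (reindex (@mon1 1)) /=; last by apply: onW_bij; apply: mon1_bij.
apply: eq_bigr => k _; congr (_ *: _); rewrite (bigD1 k) //= mnm1E eqxx expr1.
by rewrite big1 ?mulr1 // => l lk; rewrite mnm1E eq_sym (negbTE lk) expr0.
Qed.

Lemma binary_diff1E a (al : vec K ('I_a.+1 * mon 1 1)%type) (p v : vec K 'I_2) :
  binary_diff al p v = binary_map al v.
Proof.
apply/ffunP => i; rewrite binary_map1E ffunE; apply: eq_bigr => k _; congr (_ * _).
rewrite /peval /pderiv binary_form1E (raddf_sum (mderiv (enum_rank k))).
rewrite (raddf_sum (meval _)) /= (bigD1 k) //= big1.
  rewrite addr0 mderivZ mevalZ mderivX mnm1E eqxx scale1r.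
  rewrite (_ : (U_(enum_rank k) - U_(enum_rank k))%MM = 0%MM).
    by rewrite mpolyX0 meval1 mulr1.
  by apply/mnmP => j; rewrite mnmBE subnn mnm0E.
move=> l lk; rewrite mderivZ mevalZ mderivX mnm1E (inj_eq enum_rank_inj) (negbTE lk).
by rewrite scale0r meval0 mulr0.
Qed.

(** A base-point-free system of degree 1 is an injective linear map and is its own differential, so
    the factor of degree 1 alone separates points and tangent vectors. *)
Lemma nondeg_embedding a1 a2 d1 d2 (al : vec K ('I_a1.+1 * mon 1 d1)%type)
    (be : vec K ('I_a2.+1 * mon 1 d2)%type) :
  d1 = 1%N \/ d2 = 1%N -> nondeg al -> nondeg be -> embedding al be.
Proof.
move=> d12 nda ndb; split=> [p p0|p q p0 q0 eal ebe|p v p0 dal dbe].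
- by split; [apply: nda | apply: ndb].
- by case: d12 => d; subst; [apply: nondeg1_line eal | apply: nondeg1_line ebe].
by case: d12 => d; subst;
  [move: dal | move: dbe]; rewrite binary_diff1E => /vlineP [c /nondeg1_inj ->] //;
  rewrite memvZ ?memv_line.
Qed.

Lemma embedding_nondeg a1 a2 d1 d2 (al : vec K ('I_a1.+1 * mon 1 d1)%type)
    (be : vec K ('I_a2.+1 * mon 1 d2)%type) :
  embedding al be -> nondeg al /\ nondeg be.
Proof. by case=> H _ _; split=> p /H []. Qed.

Lemma nondeg0P a (al : vec K ('I_a.+1 * mon 1 0)%type) :
  nondeg al <-> exists i, al (i, mon0 1) != 0.
Proof.
split=> [nd|[i ali] p _]; last first.
  by apply/vec_neq0P; exists i; rewrite binary_map0E.
have [p p0] := exists_vec2.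
have /vec_neq0P [i ui] := nd _ p0.
by exists i; rewrite -(binary_map0E al p).
Qed.

Definition minor1 a (al : vec K ('I_a.+1 * mon 1 1)%type) i j : K :=
  (al (i, mon1 ord0) : K) * al (j, mon1 ord_max) -
  (al (i, mon1 ord_max) : K) * al (j, mon1 ord0).

Lemma sum_ord2 (F : 'I_2 -> K) : \sum_k F k = F ord0 + F ord_max.
Proof.
by rewrite big_ord_recl big_ord1; congr (_ + F _); apply: val_inj.
Qed.

Lemma ord2P (k : 'I_2) : k = ord0 \/ k = ord_max.
Proof. by case: k => -[|[|//]] ?; [left|right]; apply: val_inj. Qed.

Lemma nondeg1P a (al : vec K ('I_a.+1 * mon 1 1)%type) :
  nondeg al <-> exists i j, minor1 al i j != 0.
Proof.
split=> [nd|[i [j mij]] p p0].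
  apply: contrapT => H.
  have H' i j : minor1 al i j = 0.
    by apply: contrapT => /eqP m0; apply: H; exists i, j.
  (* The vector [q i] is orthogonal to the row i of the coefficients; if all minors vanish, it is
     orthogonal to every row, hence in the kernel. *)
  pose q i : vec K 'I_2 :=
    [ffun k => if k == ord0 then al (i, mon1 ord_max) else - al (i, mon1 ord0)].
  have q0 i : binary_map al (q i) = 0.
    apply/ffunP => j; rewrite binary_map1E sum_ord2 !ffunE /= mulrN.
    by rewrite -[RHS](H' j i) /minor1; ring.
  have qz i : q i = 0.
    by apply: contrapT => /eqP /nd; rewrite q0 eqxx.
  have [p p0] := exists_vec2.
  have /vec_neq0P [i /eqP[]] := nd _ p0; rewrite binary_map1E sum_ord2.
  have /ffunP qi := qz i; have := qi ord0; have := qi ord_max; rewrite !ffunE /=.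
  by move=> /eqP; rewrite oppr_eq0 => /eqP -> ->; rewrite !mul0r addr0.
apply: contraNneq mij => /ffunP alp.
have E k : binary_map al p k = 0 by rewrite alp ffunE.
have := E i; have := E j; rewrite !binary_map1E !sum_ord2 /minor1.
have /vec_neq0P [k pk] := p0.
case: (ord2P k) pk => -> pk ej ei; apply/eqP/(mulfI pk); rewrite mulr0.
  rewrite -[RHS](subrr 0) -{1}(mul0r (al (j, mon1 ord_max))) -{1}ei.
  by rewrite -(mul0r (al (i, mon1 ord_max))) -{1}ej; ring.
rewrite -[RHS](subrr 0) -{1}(mul0r (al (i, mon1 ord0))) -{1}ej.
by rewrite -(mul0r (al (j, mon1 ord0))) -{1}ei; ring.
Qed.

(** The witness g is a nonzero coefficient when d = 0 and a nonzero 2 x 2 minor when d = 1. The last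
    clause expresses that g is polynomial, in a form that applies to every algebra of functions. *)
Lemma nondeg_open a d (al : vec K ('I_a.+1 * mon 1 d)%type) : (d <= 1)%N -> nondeg al ->
  exists g : vec K ('I_a.+1 * mon 1 d)%type -> K,
  [/\ g al != 0, forall al', g al' != 0 -> nondeg al' &
    forall X (A : (X -> K) -> Prop) (c : X -> vec K _), fun_algebra A ->
      (forall i, A (fun x => c x i)) -> A (fun x => g (c x))].
Proof.
case: d al => [|[|//]] al _.
  move=> /nondeg0P [i ali]; exists (fun al => al (i, mon0 1)); split=> // al' H.
  by apply/nondeg0P; exists i.
move=> /nondeg1P [i [j m0]]; exists (fun al => minor1 al i j); split=> // [al' H|X A c hA Ac].
  by apply/nondeg1P; exists i, j.
by apply: (fa_sub hA); apply: (fa_mul hA).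
Qed.

(** For d = 1 the images u and v are linearly independent, and L is the form v_j X_i - v_i X_j
    attached to a nonzero minor. For d = 0 the map is constant, so L can only be asked not to
    vanish. *)
Lemma separate a d (al : vec K ('I_a.+1 * mon 1 d)%type) (p q : vec K 'I_2) :
  (d <= 1)%N -> nondeg al -> p != 0 -> q != 0 -> <[p]>%VS <> <[q]>%VS ->
  exists L : 'I_a.+1 -> K, \sum_i L i * binary_map al p i != 0 /\
    (d = 1%N -> \sum_i L i * binary_map al q i = 0).
Proof.
have S (I : finType) (i : I) (u : I -> K) c : \sum_k (if k == i then c else 0) * u k = c * u i.
  by rewrite (bigD1 i) //= eqxx big1 ?addr0 // => k /negbTE ->; rewrite mul0r.
case: d al => [|[|//]] al _ nd p0 q0 pq.
  have /vec_neq0P [i ui] := nd _ p0.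
  exists (fun k => if k == i then 1 else 0); split=> //.
  by rewrite S mul1r.
set u := binary_map al p; set v := binary_map al q.
have [[i [j uv]]|H] := pselect (exists i j, u i * v j - u j * v i != 0).
  exists (fun k => (if k == i then v j else 0) - (if k == j then v i else 0)).
  have S2 (w : 'I_a.+1 -> K) :
      \sum_k ((if k == i then v j else 0) - (if k == j then v i else 0)) * w k
       = v j * w i - v i * w j.
    by rewrite -!S -sumrB; apply: eq_bigr => k _; rewrite mulrBl.
  split=> [|_]; rewrite S2; last by rewrite mulrC subrr.
  by rewrite mulrC [v i * _]mulrC.
case: pq; apply: (nondeg1_line nd).
have /vec_neq0P [j vj] : v != 0 by apply: nd.
have uE : u = (u j / v j) *: v.
  apply/ffunP => i; rewrite vec_scaleE mulrAC; apply: (mulIf vj); rewrite mulfVK //.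
  by apply/eqP; rewrite -subr_eq0; apply: contraT => uv; case: H; exists i, j.
rewrite -/u -/v uE line_scale //.
by apply: contraTneq (nd _ p0) => c0; rewrite -/u uE c0 scale0r eqxx.
Qed.

End BinaryMaps.

(** * Restriction of sections to a curve *)

Section Restriction.
Variable K : numClosedFieldType.

(** The point (1 : k) of the projective line. In characteristic 0 these are pairwise distinct, so
    there are as many test points as needed. *)
Definition pt (k : nat) : vec K 'I_2 := [ffun i => if i == ord0 then 1 else k%:R].

Lemma pt_neq0 k : pt k != 0.
Proof. by apply/vec_neq0P; exists ord0; rewrite ffunE oner_neq0. Qed.

Lemma pt_line k l : <[pt k]>%VS = <[pt l]>%VS -> k = l.
Proof.
move=> /line_eq [c _ e]; have := congr1 (fun v : vec K 'I_2 => v ord0) e.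
have := congr1 (fun v : vec K 'I_2 => v ord_max) e.
rewrite /= !vec_scaleE !ffunE /= mulr1 => kl c1; move: kl; rewrite -c1 mul1r => /eqP.
by rewrite eqr_nat => /eqP.
Qed.

Lemma prod_xmono n b (f : {ffun 'I_b -> 'I_n.+1}) :
  exists mu : mon n b, forall x : 'I_n.+1 -> K, \prod_r x (f r) = xmono mu x.
Proof.
pose m : 'X_{1..n.+1} := (\sum_r U_(f r))%MM.
have md : mdeg m = b.
  rewrite /m mdeg_sum (eq_bigr (fun=> 1%N)) => [|r _]; last by rewrite mdeg1.
  by rewrite sum1_card card_ord.
exists (mon_of md) => x; rewrite /xmono /=.
under [RHS]eq_bigr => i _ do rewrite mnm_sumE -prodrXr.
rewrite exchange_big /=; apply: eq_bigr => r _.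
rewrite (bigD1 (f r)) //= mnm1E eqxx expr1 big1 ?mulr1 // => i ir.
by rewrite mnm1E eq_sym (negbTE ir).
Qed.

Lemma prod_linear_sum n b (L : 'I_b -> 'I_n.+1 -> K) :
  exists c : mon n b -> K, forall x : 'I_n.+1 -> K,
    \prod_r \sum_i L r i * x i = \sum_mu c mu * xmono mu x.
Proof.
have /fin_all_exists [g gP] := @prod_xmono n b.
exists (fun mu => \sum_(f : {ffun 'I_b -> 'I_n.+1} | g f == mu) \prod_r L r (f r)) => x.
rewrite bigA_distr_bigA /= (partition_big g xpredT) //=.
apply: eq_bigr => mu _; rewrite mulr_suml; apply: eq_bigr => f /eqP <-.
by rewrite big_split /= gP.
Qed.

(** To isolate lam k0, a product of b1 linear forms in x and b2 in y must vanish at the b1 d1 + b2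
    d2 other test points but not at k0. One linear form is spent on each point; a factor of degree 0
    can kill no point, but it also adds none to the count. *)
Lemma eval_indep a1 a2 d1 d2 (al : vec K ('I_a1.+1 * mon 1 d1)%type)
    (be : vec K ('I_a2.+1 * mon 1 d2)%type) b1 b2
    (lam : 'I_(b1 * d1 + b2 * d2).+1 -> K) :
  (d1 <= 1)%N -> (d2 <= 1)%N -> nondeg al -> nondeg be ->
  (forall mu : bimon a1 a2 b1 b2,
    \sum_k lam k * bimono mu (binary_map al (pt k)) (binary_map be (pt k)) = 0) ->
  forall k, lam k = 0.
Proof.
move=> d1le d2le nda ndb H k0; set e := (b1 * d1 + b2 * d2)%N in lam H k0 *.
pose x (k : nat) := binary_map al (pt k); pose y (k : nat) := binary_map be (pt k).
have HL (L : 'I_b1 -> 'I_a1.+1 -> K) (M : 'I_b2 -> 'I_a2.+1 -> K) :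
    \sum_(k < e.+1) lam k * ((\prod_r \sum_i L r i * x k i) *
                             (\prod_r \sum_i M r i * y k i)) = 0.
  have [c cP] := prod_linear_sum L; have [c' c'P] := prod_linear_sum M.
  under eq_bigr => k _ do rewrite cP c'P big_distrlr /= pair_bigA /= mulr_sumr.
  rewrite exchange_big big1 //= => mu _.
  rewrite -[RHS](mulr0 (c mu.1 * c' mu.2)) -[in RHS](H mu) mulr_sumr.
  by apply: eq_bigr => k _; rewrite /bimono; ring.
have bump_line n : <[pt k0]>%VS <> <[pt (bump k0 n)]>%VS.
  by move/pt_line/eqP; rewrite (negbTE (neq_bump _ _)).
(* [bump k0] enumerates the points other than k0: the first b1 d1 of them are left to the forms L,
   the remaining b2 d2 to the forms M. *)
have /fin_all_exists [L LP] (r : 'I_b1) :=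
  separate d1le nda (pt_neq0 k0) (pt_neq0 (bump k0 r)) (@bump_line r).
have /fin_all_exists [M MP] (r : 'I_b2) :=
  separate d2le ndb (pt_neq0 k0) (pt_neq0 (bump k0 (b1 * d1 + r)))
    (@bump_line (b1 * d1 + r)%N).
have := HL L M; rewrite (bigD1 k0) //= [X in _ + X]big1 ?addr0 => [|k].
  move/eqP; rewrite !mulf_eq0 => /orP[/eqP //|/orP[]] /prodf_eq0 [r _].
    by rewrite (negbTE (LP r).1).
  by rewrite (negbTE (MP r).1).
case: (unliftP k0 k) => [n -> _|-> /eqP //].
have [nb|nb] := ltnP n (b1 * d1).
  have d11 : d1 = 1%N by move: nb d1le; case: (d1) => [|[|]] //; rewrite muln0.
  have nb1 : (n < b1)%N by move: nb; rewrite d11 muln1.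
  have Z : \sum_i L (Ordinal nb1) i * x (lift k0 n) i = 0 := (LP (Ordinal nb1)).2 d11.
  by rewrite (bigD1 (Ordinal nb1)) //= Z !mul0r mulr0.
have ne : (n < b1 * d1 + b2 * d2)%N := ltn_ord n.
have d21 : d2 = 1%N.
  move: ne d2le nb; case: (d2) => [|[|]] //; rewrite muln0 addn0 => nn _.
  by rewrite leqNgt nn.
have nb2 : (n - b1 * d1 < b2)%N by move: ne nb; rewrite d21; lia.
rewrite [X in _ * (_ * X)](bigD1 (Ordinal nb2)) //= [X in _ * (_ * (X * _))](_ : _ = 0).
  by rewrite mul0r !mulr0.
by rewrite -[RHS]((MP (Ordinal nb2)).2 d21) /= subnKC.
Qed.

Definition pjoin (I J : finType) (x : vec K I) (y : vec K J) : vec K (I + J)%type :=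
  [ffun i => match i with inl i => x i | inr j => y j end].

Lemma lpart_pjoin (I J : finType) (x : vec K I) (y : vec K J) : lpart (pjoin x y) = x.
Proof. by apply/ffunP => i; rewrite !ffunE. Qed.

Lemma rpart_pjoin (I J : finType) (x : vec K I) (y : vec K J) : rpart (pjoin x y) = y.
Proof. by apply/ffunP => i; rewrite !ffunE. Qed.

Lemma pjoin_parts (I J : finType) (z : vec K (I + J)%type) :
  pjoin (lpart z) (rpart z) = z.
Proof. by apply/ffunP => -[i|i]; rewrite !ffunE. Qed.

Lemma biform_scale a1 a2 b1 b2 (s : vec K (bimon a1 a2 b1 b2)) x y (c c' : K) :
  peval (biform s) (pjoin (c *: x) (c' *: y)) =
  c ^+ b1 * c' ^+ b2 * peval (biform s) (pjoin x y).
Proof.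
rewrite !peval_biform mulr_sumr; apply: eq_bigr => mu _; rewrite /bimono.
set X := fun i => pjoin x y (inl i); set Y := fun i => pjoin x y (inr i).
have -> : xmono mu.1 (fun i => pjoin (c *: x) (c' *: y) (inl i)) = c ^+ b1 * xmono mu.1 X.
  by apply: xmono_scale => i; rewrite /X !ffunE.
have -> : xmono mu.2 (fun i => pjoin (c *: x) (c' *: y) (inr i)) = c' ^+ b2 * xmono mu.2 Y.
  by apply: xmono_scale => i; rewrite /Y !ffunE.
by ring.
Qed.

Lemma biform_scalel a1 a2 b1 b2 (s : vec K (bimon a1 a2 b1 b2)) z (c : K) :
  peval (biform (c *: s)) z = c * peval (biform s) z.
Proof.
rewrite !peval_biform mulr_sumr; apply: eq_bigr => mu _.
by rewrite vec_scaleE mulrA.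
Qed.

Definition curve_value a1 a2 d1 d2 (al : vec K ('I_a1.+1 * mon 1 d1)%type)
    (be : vec K ('I_a2.+1 * mon 1 d2)%type) b1 b2 (s : vec K (bimon a1 a2 b1 b2)) p :=
  peval (biform s) (pjoin (binary_map al p) (binary_map be p)).

Lemma curve_value_scale a1 a2 d1 d2 (al : vec K ('I_a1.+1 * mon 1 d1)%type)
    (be : vec K ('I_a2.+1 * mon 1 d2)%type) b1 b2 (s : vec K (bimon a1 a2 b1 b2)) p
    (c : K) :
  curve_value al be s (c *: p) = c ^+ (b1 * d1 + b2 * d2) * curve_value al be s p.
Proof.
rewrite /curve_value !binary_map_scale biform_scale -!exprM -exprD.
by rewrite (mulnC d1) (mulnC d2).
Qed.

Definition is_poly_deg e (h : K -> K) :=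
  exists2 p : {poly K}, (size p <= e.+1)%N & forall t, h t = p.[t].

Lemma is_poly_deg_sum (I : finType) e (F : I -> K -> K) :
  (forall i, is_poly_deg e (F i)) -> is_poly_deg e (fun t => \sum_i F i t).
Proof.
move=> HF; have /fin_all_exists2 [p pe Fp] := HF.
exists (\sum_i p i) => [|t]; last by rewrite horner_sum; apply: eq_bigr.
by apply: (leq_trans (size_sum _ _ _)); apply/bigmax_leqP.
Qed.

Lemma is_poly_deg_mul e e' f g :
  is_poly_deg e f -> is_poly_deg e' g -> is_poly_deg (e + e') (fun t => f t * g t).
Proof.
move=> [p pe fp] [q qe gq]; exists (p * q) => [|t]; last by rewrite hornerM fp gq.
by apply: leq_trans (size_polyMleq _ _) _; move: pe qe; lia.
Qed.

Lemma is_poly_deg_const e (c : K) : is_poly_deg e (fun=> c).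
Proof. by exists c%:P => [|t]; rewrite ?hornerC // (leq_trans (size_polyC_leq1 _)). Qed.

Lemma is_poly_deg_xmono n b e (x : 'I_n.+1 -> K -> K) (mu : mon n b) :
  (forall i, is_poly_deg e (x i)) -> is_poly_deg (b * e) (fun t => xmono mu (fun i => x i t)).
Proof.
move=> Hx; rewrite -[X in (X * _)%N](mon_mdeg mu) mdegE /xmono big_distrl /=.
elim: (index_enum _) => [|i r IHr].
  exists 1 => [|t]; first by rewrite size_poly1.
  by rewrite !big_nil hornerC.
rewrite big_cons.
case: (is_poly_deg_mul (e := (val mu) i * e) (f := fun t => x i t ^+ (val mu) i) _ IHr).
  elim: ((val mu) i) => [|k IHk]; first by exists 1; rewrite ?size_poly1 // => t; rewrite hornerC.
  have [p pe xp] := is_poly_deg_mul (Hx i) IHk.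
  by exists p => // t; rewrite exprS xp.
by move=> p pe xp; exists p => // t; rewrite -xp big_cons.
Qed.

Lemma curve_value_poly a1 a2 d1 d2 (al : vec K ('I_a1.+1 * mon 1 d1)%type)
    (be : vec K ('I_a2.+1 * mon 1 d2)%type) b1 b2 (s : vec K (bimon a1 a2 b1 b2))
    (p : K -> vec K 'I_2) : (forall k, is_poly_deg 1 (fun t => p t k)) ->
  is_poly_deg (b1 * d1 + b2 * d2) (fun t => curve_value al be s (p t)).
Proof.
move=> Hp.
have Hmap a d (ga : vec K ('I_a.+1 * mon 1 d)%type) i :
    is_poly_deg d (fun t => binary_map ga (p t) i).
  have [q qd qP] : is_poly_deg d (fun t => \sum_(mu : mon 1 d) (ga (i, mu) : K) * xmono mu (p t)).
    apply: is_poly_deg_sum => mu.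
    have := is_poly_deg_mul (is_poly_deg_const 0 (ga (i, mu))) (is_poly_deg_xmono mu Hp).
    by rewrite add0n muln1.
  by exists q => // t; rewrite binary_mapE qP.
have [q qd qP] : is_poly_deg (b1 * d1 + b2 * d2) (fun t => \sum_(mu : bimon a1 a2 b1 b2)
    (s mu : K) * (xmono mu.1 (fun i => binary_map al (p t) i) *
            xmono mu.2 (fun i => binary_map be (p t) i))).
  apply: is_poly_deg_sum => mu; rewrite -[X in is_poly_deg X]add0n.
  apply: is_poly_deg_mul; first exact: is_poly_deg_const.
  by apply: is_poly_deg_mul; apply: is_poly_deg_xmono.
exists q => // t; rewrite -qP /curve_value peval_biform; apply: eq_bigr => mu _.
by congr *%R; rewrite /bimono; congr *%R; congr xmono; apply/funext => i; rewrite !ffunE.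
Qed.

(** On the curve s becomes a binary form of degree b1 d1 + b2 d2. One root more than the degree
    kills its dehomogenization, which covers all points with nonzero first coordinate. *)
Lemma curve_value_eq0 a1 a2 d1 d2 (al : vec K ('I_a1.+1 * mon 1 d1)%type)
    (be : vec K ('I_a2.+1 * mon 1 d2)%type) b1 b2 (s : vec K (bimon a1 a2 b1 b2)) :
  (forall k : 'I_(b1 * d1 + b2 * d2).+1, curve_value al be s (pt k) = 0) ->
  forall p, curve_value al be s p = 0.
Proof.
move=> H.
pose p1 (t : K) : vec K 'I_2 := [ffun i => if i == ord0 then 1 else t].
have [q qe qP] : is_poly_deg (b1 * d1 + b2 * d2) (fun t => curve_value al be s (p1 t)).
  apply: curve_value_poly => k; case: (ord2P k) => ->.
    by exists 1; rewrite ?size_poly1 // => t; rewrite ffunE hornerC.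
  by exists 'X; rewrite ?size_polyX // => t; rewrite ffunE hornerX.
have q0 : q = 0.
  apply: contrapT => /eqP q0.
  suff roots : all (root q) [seq i%:R | i <- iota 0 (b1 * d1 + b2 * d2).+1].
    have := max_poly_roots q0 roots.
    rewrite map_inj_uniq ?iota_uniq => [/(_ isT)|i j /eqP]; last by rewrite eqr_nat => /eqP.
    by rewrite size_map size_iota ltnNge qe.
  apply/allP => x /mapP [i ie ->]; move: ie; rewrite mem_iota add0n => /andP [_ ie].
  by rewrite /root -qP -[X in _ == X](H (Ordinal ie)).
have nz (p : vec K 'I_2) : p ord0 != 0 -> curve_value al be s p = 0.
  move=> p0; have -> : p = p ord0 *: p1 (p ord_max / p ord0).
    apply/ffunP => k; rewrite vec_scaleE ffunE; case: (ord2P k) => -> /=.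
      by rewrite mulr1.
    by rewrite mulrC mulfVK.
  by rewrite curve_value_scale qP q0 horner0 mulr0.
move=> p.
(* A point with first coordinate 0 is reached by moving p along the first axis: the value r(t)
   vanishes unless t + p_0 = 0, so (X + p_0) r = 0 and r = 0. *)
pose p2 (t : K) : vec K 'I_2 := [ffun i => if i == ord0 then p i + t else p i].
have [r _ rP] : is_poly_deg (b1 * d1 + b2 * d2) (fun t => curve_value al be s (p2 t)).
  apply: curve_value_poly => k; case: (ord2P k) => ->.
    exists ('X + (p ord0)%:P); rewrite ?size_XaddC // => t.
    by rewrite ffunE hornerD hornerX hornerC addrC.
  exists (p ord_max)%:P; rewrite ?(leq_trans (size_polyC_leq1 _)) // => t.
  by rewrite ffunE hornerC.
have r0 : ('X + (p ord0)%:P) * r = 0.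
  apply: poly_eval0 => t; rewrite hornerM hornerD hornerX hornerC -rP.
  have [->|pt0] := eqVneq (t + p ord0) 0; first by rewrite mul0r.
  by rewrite nz ?mulr0 // ffunE /= addrC.
have -> : p = p2 0 by apply/ffunP => k; rewrite ffunE addr0 if_same.
rewrite rP; move/eqP: r0; rewrite mulf_eq0 -size_poly_eq0 size_XaddC => /eqP ->.
by rewrite horner0.
Qed.

(** * The matrix of the conditions that a curve imposes on the equations *)

Section Matrix.
Variables (a1 a2 m : nat) (A : 'M[nat]_(2, m)) (d1 d2 : nat).

Definition rows : finType := {j : 'I_m & 'I_(A ord0 j * d1 + A ord_max j * d2).+1}.
Definition secs : finType := {j : 'I_m & bimon a1 a2 (A ord0 j) (A ord_max j)}.

Variables (al : vec K ('I_a1.+1 * mon 1 d1)%type) (be : vec K ('I_a2.+1 * mon 1 d2)%type).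

Definition restr_coef (r : rows) (c : secs) : K :=
  if tag r == tag c then
    bimono (tagged c) (binary_map al (pt (tagged r))) (binary_map be (pt (tagged r)))
  else 0.

(* The curve (al, be) lies on V(w) iff each w_j vanishes at sufficiently many of its
   points; [restr] is the matrix of these conditions. *)
Definition restr : 'M[K]_(#|rows|, #|secs|) :=
  \matrix_(r, c) restr_coef (enum_val r) (enum_val c).

Definition wcol (w : vec K secs) : 'cV[K]_#|secs| := \col_c w (enum_val c).

Definition sec (j : 'I_m) (mu : bimon a1 a2 (A ord0 j) (A ord_max j)) : secs :=
  Tagged (fun j => bimon a1 a2 (A ord0 j) (A ord_max j)) mu.

Lemma sum_secs (j : 'I_m) (F : secs -> K) :
  \sum_(c | j == tag c) F c = \sum_mu F (@sec j mu).
Proof.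
have : \sum_(k < m | k == j) \sum_mu F (@sec k mu) =
    \sum_(p : secs | (tag p == j) && true) F (sec (tagged p)).
  exact: (sig_big_dep (fun k => k == j) (fun k => xpredT) (fun k mu => F (@sec k mu))).
rewrite big_pred1_eq => ->.
by apply: eq_big => -[k mu] //=; rewrite andbT eq_sym.
Qed.

Lemma restrE (w : vec K secs) (r : rows) :
  (restr *m wcol w) (enum_rank r) 0 =
  curve_value al be (component w (tag r)) (pt (tagged r)).
Proof.
rewrite mxE /curve_value peval_biform.
rewrite (reindex_onto enum_rank enum_val) => [|k _]; last exact: enum_valK.
rewrite (eq_bigl xpredT) => [|k]; last by rewrite enum_rankK eqxx.
rewrite (bigID (fun c => tag r == tag c)) /= [X in _ + X]big1 => [|c rc]; last first.
  by rewrite !mxE !enum_rankK /restr_coef (negbTE rc) mul0r.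
rewrite addr0 sum_secs; apply: eq_bigr => mu _.
rewrite !mxE !enum_rankK /restr_coef /= eqxx mulrC [component _ _ _]ffunE; congr (_ * _).
by rewrite /bimono; congr *%R; congr xmono; apply/funext => i; rewrite !ffunE.
Qed.

Lemma restr_ker (w : vec K secs) : restr *m wcol w = 0 <->
  forall j p, curve_value al be (component w j) p = 0.
Proof.
split=> [Ew j|Ew].
  apply: curve_value_eq0 => k.
  pose r : rows := Tagged (fun j => 'I_(A ord0 j * d1 + A ord_max j * d2).+1) k.
  by have := restrE w r; rewrite Ew mxE => <-.
by apply/matrixP => r c; rewrite ord1 -[r]enum_valK restrE Ew mxE.
Qed.

(** The matrix is block diagonal, so a left kernel vector restricts on each block j to a relation
    between the evaluations at the test points. *)
Lemma restr_row_free : (d1 <= 1)%N -> (d2 <= 1)%N -> nondeg al -> nondeg be ->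
  row_free restr.
Proof.
move=> d1le d2le nda ndb; rewrite -kermx_eq0; apply/rowV0P => u /sub_kermxP uE.
apply/rowP => r0; rewrite mxE -[r0]enum_valK; case: (enum_val r0) => j k.
pose row_of (k : 'I_(A ord0 j * d1 + A ord_max j * d2).+1) : rows :=
  Tagged (fun j => 'I_(A ord0 j * d1 + A ord_max j * d2).+1) k.
apply: (eval_indep (lam := fun k => u 0 (enum_rank (row_of k))) d1le d2le nda ndb) => mu.
have := congr1 (fun v : 'rV_#|secs| => v 0 (enum_rank (sec mu))) uE.
rewrite !mxE => e; rewrite -[RHS]e.
rewrite [RHS](reindex_onto enum_rank enum_val) => [|l _]; last exact: enum_valK.
rewrite [RHS](eq_bigl xpredT) => [|l]; last by rewrite enum_rankK eqxx.
rewrite [RHS](bigID (fun r => j == tag r)) /= [X in _ = _ + X]big1 => [|r jr]; last first.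
  by rewrite !mxE !enum_rankK /restr_coef eq_sym (negbTE jr) mulr0.
rewrite addr0.
pose G (r : rows) := u 0 (enum_rank r) * restr (enum_rank r) (enum_rank (sec mu)).
have : \sum_(i < m | i == j) \sum_(l : 'I_(A ord0 i * d1 + A ord_max i * d2).+1)
      G (Tagged (fun j => 'I_(A ord0 j * d1 + A ord_max j * d2).+1) l) =
    \sum_(p : rows | (tag p == j) && true)
      G (Tagged (fun j => 'I_(A ord0 j * d1 + A ord_max j * d2).+1) (tagged p)).
  exact: (sig_big_dep (fun k => k == j) (fun k => xpredT)
    (fun i l => G (Tagged (fun j => 'I_(A ord0 j * d1 + A ord_max j * d2).+1) l))).
rewrite big_pred1_eq => H.
transitivity (\sum_(l : 'I_(A ord0 j * d1 + A ord_max j * d2).+1)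
  u 0 (enum_rank (row_of l)) * restr (enum_rank (row_of l)) (enum_rank (sec mu))).
  by apply: eq_bigr => l _; rewrite mxE !enum_rankK /restr_coef /= eqxx.
by rewrite H; apply: eq_big => [[i l]|[i l] _] //=; rewrite andbT eq_sym.
Qed.

End Matrix.
End Restriction.

(** * Limits and singular points *)

(** These families replace sequences: shrinking the sets plays the role of passing to a subsequence,
    and no points have to be chosen. *)
Definition decreasing_family (T : Type) (S : nat -> set T) :=
  (forall n, S n !=set0) /\ (forall n k, (n <= k)%N -> S k `<=` S n).

Section Limits.
Variables (K : numClosedFieldType) (T : Type).

Definition conv (S : nat -> set T) (h : T -> K) (c : K) :=
  forall e : K, 0 < e -> exists N, forall z, S N z -> `|h z - c| < e.

Lemma conv_sub (S S' : nat -> set T) h c :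
  (forall n, S' n `<=` S n) -> conv S h c -> conv S' h c.
Proof. by move=> SS hc e /hc [N HN]; exists N => z /SS /HN. Qed.

(** [None] is a limit point adjoined to T. The predicate is continuity at [None] along S, so the
    limit theorems become closure properties of an algebra of functions on [option T]. *)
Definition conv_fun (S : nat -> set T) (h : option T -> K) :=
  conv S (fun z => h (Some z)) (h None).

Lemma conv_algebra (S : nat -> set T) : decreasing_family S -> fun_algebra (conv_fun S).
Proof.
move=> [_ Sdec]; split=> [c e e0|f g fc gc e e0|f g fc gc e e0].
- by exists 0%N => z _; rewrite subrr normr0.
- have e2 : 0 < e / 2 by rewrite divr_gt0.
  have [N1 H1] := fc _ e2; have [N2 H2] := gc _ e2.
  exists (maxn N1 N2) => z Sz.
  have h1 := H1 z (Sdec _ _ (leq_maxl _ _) _ Sz).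
  have h2 := H2 z (Sdec _ _ (leq_maxr _ _) _ Sz).
  rewrite opprD addrACA (le_lt_trans (ler_normD _ _)) // [e]splitr.
  exact: ltrD h1 h2.
- set a := f None; set b := g None.
  have a0 : 0 < 2 * (`|a| + 1) by rewrite mulr_gt0 // ltr_wpDl.
  have b0 : 0 < 2 * (`|b| + 1) by rewrite mulr_gt0 // ltr_wpDl.
  have [N1 H1] := fc _ (divr_gt0 e0 b0); have [N2 H2] := gc _ (divr_gt0 e0 a0).
  have [N3 H3] := gc _ ltr01.
  exists (maxn N1 (maxn N2 N3)) => z Sz.
  have h1 := H1 z (Sdec _ _ (leq_maxl _ _) _ Sz).
  have Sz' := Sdec _ _ (leq_maxr N1 (maxn N2 N3)) _ Sz.
  have h2 := H2 z (Sdec _ _ (leq_maxl _ _) _ Sz').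
  have h3 := H3 z (Sdec _ _ (leq_maxr _ _) _ Sz').
  have gb : `|g (Some z)| <= `|b| + 1.
    rewrite -[g _](subrK b) (le_trans (ler_normD _ _)) // addrC lerD2l; exact: ltW.
  rewrite [X in `|X|](_ : _ = (f (Some z) - a) * g (Some z) + a * (g (Some z) - b));
    last by rewrite /a /b; ring.
  rewrite (le_lt_trans (ler_normD _ _)) // !normrM [e]splitr.
  apply: ler_ltD.
    apply: (@le_trans _ _ (e / (2 * (`|b| + 1)) * (`|b| + 1))).
      by apply: ler_pM => //; apply: ltW.
    by rewrite invfM mulrA mulfVK // gt_eqF // ltr_wpDl.
  apply: (@le_lt_trans _ _ ((`|a|) * (e / (2 * (`|a| + 1))))).
    by apply: ler_wpM2l => //; apply: ltW.
  apply: (@lt_le_trans _ _ ((`|a| + 1) * (e / (2 * (`|a| + 1))))).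
    by rewrite ltr_pM2r ?ltrDl // divr_gt0.
  by rewrite mulrC invfM mulrA mulfVK // gt_eqF // ltr_wpDl.
Qed.

Lemma conv_eq0 (S : nat -> set T) h : decreasing_family S -> conv_fun S h ->
  (forall n z, S n z -> h (Some z) = 0) -> h None = 0.
Proof.
move=> [S0 _] hc hz; apply: contrapT => /eqP; rewrite -normr_gt0 => h0.
have [N HN] := hc _ h0; have [z Sz] := S0 N.
by have := HN z Sz; rewrite (hz N) // sub0r normrN ltxx.
Qed.

End Limits.

(** The Archimedean property, and Bolzano-Weierstrass for finitely many bounded functions at
    once. *)
Record locally_compact (K : numClosedFieldType) : Prop := LocallyCompact {
  inv_nat_small : forall e : K, 0 < e -> exists n, n.+1%:R^-1 < e;
  finite_cluster : forall (T : Type) (I : finType) (S : nat -> set T) (u : I -> T -> K),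
    decreasing_family S -> (forall i z, S 0%N z -> `|u i z| <= 1) ->
    exists S' c, [/\ decreasing_family S', forall n, S' n `<=` S n &
      forall i, conv S' (u i) (c i)] }.

(** * Cluster values of bounded complex functions *)

Section ComplexLimits.
Variable R : realType.
Let K : numClosedFieldType := R[i].

(** The value c is the limit superior, the infimum over n of the supremum of u on S n; S' n keeps
    the points of S n where u is within 1/(n+1) of c. *)
Lemma real_cluster (T : Type) (S : nat -> set T) (u : T -> R) (B : R) :
  decreasing_family S -> (forall z, S 0%N z -> `|u z| <= B) ->
  exists S' c, [/\ decreasing_family S', forall n, S' n `<=` S n &
    forall n z, S' n z -> `|u z - c| < n.+1%:R^-1].
Proof.
move=> [S0 Sdec] uB.
have ub n z : S n z -> `|u z| <= B by move=> /(Sdec 0%N n (leq0n n)) /uB.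
have hsup n : has_sup [set u z | z in S n].
  split; first by have [z Sz] := S0 n; exists (u z), z.
  by exists B => _ [z Sz <-]; apply: le_trans (ler_norm _) (ub n z Sz).
pose sg n := sup [set u z | z in S n].
have sgP n z : S n z -> u z <= sg n.
  by move=> Sz; apply: (sup_upper_bound (hsup n)); exists z.
have hinf : has_inf (range sg).
  split; first by exists (sg 0%N), 0%N.
  exists (- B) => _ [n _ <-]; have [z Sz] := S0 n.
  by apply: le_trans (sgP _ _ Sz); have := ub _ _ Sz; rewrite ler_norml => /andP[].
pose c := inf (range sg).
exists (fun n => [set z | S n z /\ `|u z - c| < n.+1%:R^-1]), c; split; last 2 first.
- by move=> n z [].
- by move=> n z [].
split=> [n|n k nk z [Sz uz]]; last first.
  split; first exact: Sdec nk _ Sz.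
  by apply: lt_le_trans uz _; rewrite lef_pV2 ?posrE ?ltr0n // ler_nat.
have e0 : 0 < n.+1%:R^-1 :> R by rewrite invr_gt0 ltr0n.
have [_ [k _ <-] skc] := inf_adherent e0 hinf.
(* The supremum on S N lies between c and c + 1/(n+1), and some point of S N has a value less than
   1/(n+1) below that supremum. *)
pose N := maxn n k.
have cN : c <= sg N by apply: ge_inf; [case: hinf | exists N].
have Nk : sg N <= sg k.
  apply: ge_sup; first by have [z Sz] := S0 N; exists (u z), z.
  by move=> _ [z Sz <-]; apply: sgP; apply: Sdec Sz; rewrite leq_maxr.
have [_ [z Sz <-] uz] := sup_adherent e0 (hsup N).
exists z; split; first by apply: Sdec Sz; rewrite leq_maxl.
have zN := sgP _ _ Sz; rewrite -/(sg N) in uz; rewrite -/c in skc.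
move: e0 uz skc cN Nk zN; rewrite ltr_norml.
by move: (_^-1) (u z) (sg N) (sg k) c => e x y y' d *; apply/andP; split; lra.
Qed.

Lemma complex_norm_le (z : K) : `|z| <= (`|complex.Re z| + `|complex.Im z|)%:C%C.
Proof.
have normR (r : R) : `|r%:C%C : K| = `|r|%:C%C by rewrite normc_def /= expr0n addr0 sqrtr_sqr.
rewrite {1}[z]complexE (le_trans (ler_normD _ _)) // normrM !normR.
by rewrite [`|'i%C|]normc_def /= expr0n add0r expr1n sqrtr1 mul1r -rmorphD.
Qed.

Lemma complex_pos (e : K) : 0 < e -> e = (complex.Re e)%:C%C /\ 0 < complex.Re e.
Proof.
case: e => a b; rewrite ltcE /= => /andP [/eqP -> a0]; split=> //.
Qed.

Lemma archi_inv (e : R) : 0 < e -> exists n, n.+1%:R^-1 < e.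
Proof.
move=> e0; exists (Num.bound e^-1).
rewrite invf_plt ?posrE ?ltr0n //; apply: lt_trans (archi_boundP _) _.
  by rewrite invr_ge0 ltW.
by rewrite ltr_nat.
Qed.

Lemma complex_cluster (T : Type) (S : nat -> set T) (u : T -> K) :
  decreasing_family S -> (forall z, S 0%N z -> `|u z| <= 1) ->
  exists S' c, [/\ decreasing_family S', forall n, S' n `<=` S n & conv S' u c].
Proof.
move=> dS uB.
have reB (z : K) : `|z| <= 1 -> `|complex.Re z| <= 1.
  by move=> z1; rewrite -lecR; apply: le_trans (normc_ge_Re _) z1.
have imB (z : K) : `|z| <= 1 -> `|complex.Im z| <= 1.
  move=> z1; rewrite -normrN -ReiNIm; apply: reB; rewrite normrM.
  by rewrite [`|'i%C|]normc_def /= expr0n add0r expr1n sqrtr1 mulr1.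
have [S1 [a [dS1 S1S ca]]] := real_cluster dS (fun z Sz => reB _ (uB z Sz)).
have uB1 z : S1 0%N z -> `|complex.Im (u z)| <= 1 by move=> /S1S /uB /imB.
have [S2 [b [dS2 S2S cb]]] := real_cluster dS1 uB1.
exists S2, (a +i* b)%C; split=> // [n z /S2S /S1S //|e /complex_pos [-> e0]].
have [N HN] := archi_inv (divr_gt0 e0 (@ltr0n R 2)).
exists N => z Sz; apply: le_lt_trans (complex_norm_le _) _; rewrite ltcR.
have h1 := lt_trans (ca _ _ (S2S _ _ Sz)) HN; have h2 := lt_trans (cb _ _ Sz) HN.
rewrite [complex.Re e]splitr; move: h1 h2; case: (u z) => x y /= h1 h2; exact: ltrD.
Qed.

Lemma complex_finite_cluster (T : Type) (I : finType) (S : nat -> set T) (u : I -> T -> K) :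
  decreasing_family S -> (forall i z, S 0%N z -> `|u i z| <= 1) ->
  exists S' c, [/\ decreasing_family S', forall n, S' n `<=` S n &
    forall i, conv S' (u i) (c i)].
Proof.
move=> dS uB.
suff [S' [c [dS' S'S cc]]] : exists S' (c : I -> K), [/\ decreasing_family S',
    forall n, S' n `<=` S n & forall i, i \in enum I -> conv S' (u i) (c i)].
  by exists S', c; split=> // i; apply: cc; rewrite mem_enum.
elim: (enum I) => [|i r [S1 [c [dS1 S1S cc]]]].
  by exists S, (fun=> 0); split=> // n z.
have uB1 z : S1 0%N z -> `|u i z| <= 1 by move=> /S1S; apply: uB.
have [S2 [a [dS2 S2S ca]]] := complex_cluster dS1 uB1.
exists S2, (fun j => if j == i then a else c j); split=> // [n z /S2S /S1S //|j].
rewrite inE; case: eqP => [-> //|_ /= jr]; exact: conv_sub S2S (cc j jr).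
Qed.

Lemma complex_locally_compact : locally_compact K.
Proof.
split; last by move=> T I S u; apply: complex_finite_cluster.
move=> e /complex_pos [-> /archi_inv [n ne]]; exists n.
by rewrite -ltcR in ne; rewrite (le_lt_trans _ ne) // rmorphV ?unitfE ?pnatr_eq0 // rmorph_nat.
Qed.

End ComplexLimits.

(** * Scaling of coordinates and singular points *)

Section Singular.
Variable K : numClosedFieldType.

(** The bound gives compactness. The vanishing product says that some entry equals 1, in the form of
    a polynomial equation: it passes to limits and keeps them away from 0. *)
Definition normalized (I : finType) (u : I -> K) :=
  (forall i, `|u i| <= 1) /\ \prod_i (u i - 1) = 0.

Lemma normalized_neq0 (I : finType) (u : I -> K) : \prod_i (u i - 1) = 0 ->
  exists i, u i != 0.
Proof.
move/eqP/prodf_eq0 => [i _]; rewrite subr_eq0 => /eqP ui.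
by exists i; rewrite ui oner_neq0.
Qed.

Lemma normalize (I : finType) (u : I -> K) i0 : u i0 != 0 ->
  exists2 c : K, c != 0 & normalized (fun i => c * u i).
Proof.
move=> u0.
have [i _ iP] := real_arg_maxP (P := xpredT) (F := fun i => `|u i|)
  (i0 := i0) isT (fun i _ => normr_real (u i)).
have ui : u i != 0.
  rewrite -normr_gt0; apply: lt_le_trans (iP i0 isT); by rewrite normr_gt0.
exists (u i)^-1; first by rewrite invr_eq0.
split=> [j|]; last by apply/eqP/prodf_eq0; exists i => //; rewrite mulVf // subrr.
by rewrite normrM normfV mulrC ler_pdivrMr ?normr_gt0 // mul1r; apply: iP.
Qed.

Variables (a1 a2 : nat).
Let V := ('I_a1.+1 + 'I_a2.+1)%type.

Definition bimnm b1 b2 (mu : bimon a1 a2 b1 b2) : 'X_{1..#|{: V}|} :=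
  [multinom match enum_val k with
            | inl i => (val mu.1 : 'X_{1..a1.+1}) i
            | inr i => (val mu.2 : 'X_{1..a2.+1}) i end | k < #|{: V}|].

Lemma prod_enum_val (F : V -> K) : \prod_(k < #|{: V}|) F (enum_val k) =
  (\prod_i F (inl i)) * \prod_i F (inr i).
Proof.
rewrite (reindex_onto enum_rank enum_val) => [|k _]; last exact: enum_valK.
rewrite (eq_bigl xpredT) => [|k]; last by rewrite enum_rankK eqxx.
under eq_bigr => k _ do rewrite enum_rankK.
exact: big_sumType.
Qed.

Lemma biformE b1 b2 (s : vec K (bimon a1 a2 b1 b2)) :
  biform s = \sum_mu (s mu : K) *: 'X_[bimnm mu].
Proof.
rewrite /biform; apply: eq_bigr => mu _; congr (_ *: _).
rewrite mpolyXE_id (reindex_onto enum_rank enum_val) => [|k _]; last exact: enum_valK.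
rewrite [RHS](eq_bigl xpredT) => [|k]; last by rewrite enum_rankK eqxx.
under [RHS]eq_bigr => k _ do rewrite mnmE enum_rankK.
by rewrite big_sumType.
Qed.

Lemma peval_pderiv_biform b1 b2 (s : vec K (bimon a1 a2 b1 b2)) (t : V) (z : vec K V) :
  peval (pderiv t (biform s)) z =
  \sum_mu (s mu : K) * peval ('X_[bimnm mu])^`M(enum_rank t) z.
Proof.
rewrite /peval /pderiv biformE (raddf_sum (mderiv (enum_rank t))).
rewrite (raddf_sum (meval _)) /=; apply: eq_bigr => mu _.
by rewrite mderivZ mevalZ.
Qed.

Definition part_scale (c c' : K) (t : V) : K := match t with inl _ => c | inr _ => c' end.

(** A derivative in the variable t has one factor c or c' less than the monomial. Multiplying it
    back on the left avoids exponents lowered by 1 and also covers an exponent equal to 0. *)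
Lemma pderiv_monomial_scale b1 b2 (mu : bimon a1 a2 b1 b2) (t : V) (x : vec K 'I_a1.+1)
    (y : vec K 'I_a2.+1) c c' :
  part_scale c c' t * peval ('X_[bimnm mu])^`M(enum_rank t) (pjoin (c *: x) (c' *: y)) =
  c ^+ b1 * c' ^+ b2 * peval ('X_[bimnm mu])^`M(enum_rank t) (pjoin x y).
Proof.
rewrite mderivX /peval !mevalZ !mevalX; set n := bimnm mu (enum_rank t).
have [->|n0] := posnP n; first by rewrite !mul0r !mulr0.
have zE k : (pjoin (c *: x) (c' *: y)) (enum_val k) =
    part_scale c c' (enum_val k) * pjoin x y (enum_val k) :> K.
  by rewrite !ffunE; case: (enum_val k) => i; rewrite vec_scaleE.
have cE : c ^+ b1 * c' ^+ b2 =
    \prod_(k < #|{: V}|) part_scale c c' (enum_val k) ^+ bimnm mu k.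
  transitivity (\prod_(k < #|{: V}|) part_scale c c' (enum_val k) ^+
     bimnm mu (enum_rank (enum_val k))); last by under eq_bigr do rewrite enum_valK.
  rewrite (prod_enum_val (fun t => part_scale c c' t ^+ bimnm mu (enum_rank t))) /=.
  under eq_bigr do rewrite mnmE enum_rankK.
  under [X in _ = _ * X]eq_bigr do rewrite mnmE enum_rankK.
  by rewrite -!expr_sum -!mdegE !mon_mdeg.
rewrite cE mulrCA [RHS]mulrCA; congr (_ * _).
under eq_bigr do rewrite zE exprMn.
rewrite big_split /= mulrA; congr (_ * _).
rewrite (bigD1 (enum_rank t)) //= [RHS](bigD1 (enum_rank t)) //= mulrA; congr (_ * _).
  rewrite enum_rankK -exprS; congr (_ ^+ _).
  by rewrite mnmBE mnm1E eqxx subn1 -/n prednK.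
apply: eq_bigr => k kt; congr (_ ^+ _).
by rewrite mnmBE mnm1E eq_sym (negbTE kt) subn0.
Qed.

Variables (m : nat) (A : 'M[nat]_(2, m)).
Let W := vec K (coords (section_space K a1 a2 A)).

Lemma jacobian_entry_scale (w w' : W) (x : vec K 'I_a1.+1) (y : vec K 'I_a2.+1)
    (c c' : K) (lam : 'I_m -> K) j k :
  (forall j, component w' j = lam j *: component w j) ->
  part_scale c c' (enum_val k) * jacobian w' (pjoin (c *: x) (c' *: y)) j k =
  lam j * (c ^+ A ord0 j * c' ^+ A ord_max j) * jacobian w (pjoin x y) j k.
Proof.
move=> wE; rewrite mxE [in RHS]mxE wE 2!peval_pderiv_biform 2!mulr_sumr.
apply: eq_bigr => mu _; have := pderiv_monomial_scale mu (enum_val k) x y c c'.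
rewrite vec_scaleE; move: (peval _ _) (peval _ _) => P Q H.
by rewrite mulrCA H; ring.
Qed.

(** Other representatives change the rows and columns of the Jacobian matrix by factors. The column
    factors c, c' are nonzero and cancel, and the row factors are absorbed into v. *)
Lemma jacobian_scale (w w' : W) (x : vec K 'I_a1.+1) (y : vec K 'I_a2.+1) (c c' : K)
    (lam : 'I_m -> K) (v : 'rV[K]_m) : c != 0 -> c' != 0 ->
  (forall j, component w' j = lam j *: component w j) ->
  v *m jacobian w' (pjoin (c *: x) (c' *: y)) = 0 ->
  (\row_j (v 0 j * (lam j * (c ^+ A ord0 j * c' ^+ A ord_max j)))) *m
    jacobian w (pjoin x y) = 0.
Proof.
move=> c0 c'0 wE vJ; apply/rowP => k; rewrite mxE [RHS]mxE.
have k0 : part_scale c c' (enum_val k) != 0 by case: (enum_val k).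
have := congr1 (fun M : 'rV_#|{: V}| => part_scale c c' (enum_val k) * M 0 k) vJ.
rewrite mxE [in RHS]mxE mulr0 mulr_sumr => e; rewrite -[RHS]e; apply: eq_bigr => j _.
by rewrite mxE -mulrA -(jacobian_entry_scale _ _ _ _ _ _ wE) mulrCA.
Qed.

(** A rank drop is recorded by a left kernel vector v: the condition is then polynomial in w, z and
    v and survives limits. That v is nonzero is imposed separately. *)
Definition singular (w : W) (z : vec K V) (v : 'rV[K]_m) :=
  (forall j, peval (biform (component w j)) z = 0) /\ v *m jacobian w z = 0.

Lemma rep_component (w w' : W) s : rep (section_space K a1 a2 A) w s ->
  rep (section_space K a1 a2 A) w' s ->
  exists lam : 'I_m -> K, forall j, lam j != 0 /\ component w' j = lam j *: component w j.
Proof.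
move=> ws w's; apply: (@fin_all_exists _ (fun=> K)
  (fun j c => c != 0 /\ component w' j = c *: component w j)) => j.
by have [c c0 e] := rep_inj (ws j) (w's j); exists c.
Qed.

Lemma zero_locusP (s : section_space K a1 a2 A) (w : W) (q : biproj K a1 a2) z :
  rep (section_space K a1 a2 A) w s -> rep (biproj K a1 a2) z q ->
  (forall j, peval (biform (component w j)) z = 0) -> zero_locus s q.
Proof.
move=> ws [zq1 zq2] H z' w' [z'q1 z'q2] w's j.
have [c c0 e1] := rep_inj zq1 z'q1; have [c' c'0 e2] := rep_inj zq2 z'q2.
have [lam lamP] := rep_component ws w's.
rewrite (lamP j).2 biform_scalel -[z']pjoin_parts e1 e2 biform_scale pjoin_parts H.
by rewrite !mulr0.
Qed.

(** A rank drop may be witnessed by any representatives; rescaling transports it to the given w and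
    to data z, v in a compact set. *)
Lemma nonsmooth_singular (s : section_space K a1 a2 A) (w : W) :
  rep (section_space K a1 a2 A) w s -> zero_locus s !=set0 -> ~ smooth_ci s ->
  exists (z : vec K V) (v : 'rV[K]_m),
    [/\ normalized (lpart z), normalized (rpart z), normalized (v 0) &
    singular w z v].
Proof.
move=> ws s0 ns.
have [q [z [w' [qs zq w's rk]]]] : exists q z w', [/\ zero_locus s q,
    rep (biproj K a1 a2) z q, rep (section_space K a1 a2 A) w' s &
    \rank (jacobian w' z) <> m].
  apply: contrapT => H; apply: ns; split=> // q z w' qs zq w's.
  by apply: contrapT => rk; apply: H; exists q, z, w'.
have [lam lamP] := rep_component ws w's.
have [v v0 vJ] : exists2 v : 'rV[K]_m, v != 0 & v *m jacobian w' z = 0.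
  have : kermx (jacobian w' z) != 0 by rewrite kermx_eq0; apply/eqP.
  by case/rowV0Pn => v /sub_kermxP vJ v0; exists v.
have [i xi] := elimT (vec_neq0P _) (rep_neq0 zq.1).
have [i' yi] := elimT (vec_neq0P _) (rep_neq0 zq.2).
have [c c0 nx] := normalize xi; have [c' c'0 ny] := normalize yi.
set x := c *: lpart z; set y := c' *: rpart z.
have zE : z = pjoin (c^-1 *: x) (c'^-1 *: y).
  by rewrite /x /y !scalerA !mulVf // !scale1r pjoin_parts.
rewrite zE in vJ.
have := jacobian_scale _ _ (fun j => (lamP j).2) vJ.
rewrite !invr_eq0 => /(_ c0 c'0); set v' := \row_j _ => v'J.
have /rV0Pn [j vj] := v0.
have v'j : v' 0 j != 0.
  by rewrite mxE !mulf_neq0 // ?(lamP j).1 // expf_neq0 // invr_eq0.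
have [d d0 nv] := normalize v'j.
have ext (I : finType) (u u' : I -> K) : normalized u -> u =1 u' -> normalized u'.
  by move=> nu /funext <-.
exists (pjoin x y), (d *: v'); rewrite lpart_pjoin rpart_pjoin; split.
- by apply: (ext _ _ _ nx) => k; rewrite vec_scaleE.
- by apply: (ext _ _ _ ny) => k; rewrite vec_scaleE.
- by apply: (ext _ _ _ nv) => k; rewrite !mxE.
split=> [k|]; last by rewrite -scalemxAl v'J scaler0.
by rewrite biform_scale pjoin_parts (qs _ _ zq ws) mulr0.
Qed.

Lemma smooth_nonsingular (s : section_space K a1 a2 A) (w : W) (z : vec K V) (v : 'rV[K]_m) :
  smooth_ci s -> rep (section_space K a1 a2 A) w s -> lpart z != 0 -> rpart z != 0 ->
  v != 0 -> ~ singular w z v.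
Proof.
move=> [_ sm] ws x0 y0 v0 [wz vJ].
pose q : biproj K a1 a2 := (ppoint x0, ppoint y0).
have zq : rep (biproj K a1 a2) z q by [].
have /eqP rk := sm _ _ _ (zero_locusP ws zq wz) zq ws.
by case/eqP: v0; apply: (row_free_inj (A := jacobian w z)) => //; rewrite mul0mx.
Qed.

End Singular.

(** * Irreducibility of the incidence variety *)

Section SmoothOpen.
Variables (K : numClosedFieldType) (a1 a2 m : nat) (A : 'M[nat]_(2, m)).
Hypothesis lcK : locally_compact K.
Let V := ('I_a1.+1 + 'I_a2.+1)%type.
Let W := vec K (coords (section_space K a1 a2 A)).

Lemma fa_biform X (B : (X -> K) -> Prop) b1 b2 (s : X -> vec K (bimon a1 a2 b1 b2))
    (z : X -> vec K V) : fun_algebra B ->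
  (forall mu, B (fun x => s x mu)) -> (forall i, B (fun x => z x i)) ->
  B (fun x => peval (biform (s x)) (z x)) /\
  forall t, B (fun x => peval (pderiv t (biform (s x))) (z x)).
Proof.
move=> hB Bs Bz.
have Bm (p : {mpoly K[#|{: V}|]}) : B (fun x => peval p (z x)).
  exact: (fa_meval hB p (fun k => Bz (enum_val k))).
split=> [|t].
  apply: (@fa_ext _ _ _ (fun x => \sum_mu (s x mu : K) * peval 'X_[bimnm mu] (z x))).
    by apply: (fa_sum hB) => mu; apply: (fa_mul hB).
  move=> x; rewrite /peval biformE (raddf_sum (meval _)); apply: eq_bigr => mu _.
  by rewrite /= mevalZ.
apply: (@fa_ext _ _ _ (fun x => \sum_mu (s x mu : K) *
    peval ('X_[bimnm mu])^`M(enum_rank t) (z x))).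
  by apply: (fa_sum hB) => mu; apply: (fa_mul hB).
by move=> x; rewrite peval_pderiv_biform.
Qed.

Lemma is_poly_fun_algebra X (B : (X -> K) -> Prop) (h : K -> K) (g : X -> K) :
  fun_algebra B -> is_poly h -> B g -> B (fun x => h (g x)).
Proof.
move=> hB [p hp] Bg.
apply: (@fa_ext _ _ _ (fun x => \sum_(i < size p) p`_i * g x ^+ i)) => [|x].
  by apply: (fa_sum hB) => i; apply: (fa_mul hB (fa_const hB _)); apply: (fa_exp hB).
by rewrite hp horner_coef.
Qed.

(** Otherwise normalized singular data (t, z, v) exist for arbitrarily small t > 0 outside the roots
    of p, and a cluster point of them is singular data at t = 0. The polynomial p allows further
    open conditions to be met at the same t. *)
Lemma smooth_open_path (w : K -> W) (s0 : section_space K a1 a2 A) (p : {poly K}) :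
  (forall c, is_poly (fun t => w t c)) -> rep (section_space K a1 a2 A) (w 0) s0 ->
  smooth_ci s0 -> p != 0 ->
  exists t, p.[t] != 0 /\ forall s, rep (section_space K a1 a2 A) (w t) s ->
    zero_locus s !=set0 -> smooth_ci s.
Proof.
move=> wpoly w0 sm p0; apply: contrapT => H.
have sing t : p.[t] != 0 -> exists (z : vec K V) (v : 'rV[K]_m),
    [/\ normalized (lpart z), normalized (rpart z), normalized (v 0) & singular (w t) z v].
  move=> pt0; apply: contrapT => ns; apply: H; exists t; split=> // s ws s0'.
  by apply: contrapT => nsm; apply: ns; apply: nonsmooth_singular ws s0' nsm.
pose T := (K * vec K V * 'rV[K]_m)%type.
pose S (n : nat) : set T := [set x : T | [/\ 0 < x.1.1 & x.1.1 < n.+1%:R^-1] /\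
  [/\ normalized (lpart x.1.2), normalized (rpart x.1.2), normalized (x.2 0) &
    singular (w x.1.1) x.1.2 x.2]].
have dS : decreasing_family S.
  split=> [n|n k nk x [[x0 xk] hx]].
    have n0 : 0 < n.+1%:R^-1 :> K by rewrite invr_gt0 ltr0n.
    have [t [t0 tn pt0]] := poly_nonroot p0 n0.
    by have [z [v hzv]] := sing t pt0; exists (t, z, v).
  split=> //; split=> //; apply: lt_le_trans xk _.
  by rewrite lef_pV2 ?posrE ?ltr0n // ler_nat.
pose I : finType := (V + 'I_m)%type.
pose u (i : I) (x : T) : K := match i with inl k => x.1.2 k | inr j => x.2 0 j end.
have uB i x : S 0%N x -> `|u i x| <= 1.
  move=> [_ [[n1 _] [n2 _] [n3 _] _]]; case: i => [[i|i]|j] /=; last exact: n3.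
    by have := n1 i; rewrite ffunE.
  by have := n2 i; rewrite ffunE.
have [S' [c [dS' S'S cc]]] := finite_cluster lcK dS uB.
have ct : conv S' (fun x : T => x.1.1) 0.
  move=> e /(inv_nat_small lcK) [n ne]; exists n => x /S'S [[x0 xn] _].
  by rewrite subr0 gtr0_norm // (lt_trans xn).
have hB := conv_algebra K dS'.
pose z0 : vec K V := [ffun k => c (inl k)].
pose v0 : 'rV[K]_m := \row_j c (inr j).
(* The cluster values become the values at [None]: an expression in [tt], [zz] and [vv] evaluates
   there at t = 0, [z0] and [v0], so its vanishing on S passes to the limit. *)
pose tt (o : option T) : K := if o is Some x then x.1.1 else 0.
pose zz (o : option T) : vec K V := if o is Some x then x.1.2 else z0.
pose vv (o : option T) : 'rV[K]_m := if o is Some x then x.2 else v0.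
have Bt : conv_fun S' tt by [].
have Bz k : conv_fun S' (fun o => zz o k) by rewrite /conv_fun /= ffunE; apply: (cc (inl k)).
have Bv j : conv_fun S' (fun o => vv o 0 j) by rewrite /conv_fun /= mxE; apply: (cc (inr j)).
have lim (h : option T -> K) : conv_fun S' h -> (forall x n, S n x -> h (Some x) = 0) -> h None = 0.
  by move=> Bh hz; apply: (conv_eq0 dS' Bh) => n x /S'S; apply: hz.
have Bw j mu : conv_fun S' (fun o => component (w (tt o)) j mu).
  pose c' : secs a1 a2 A := sec mu.
  apply: (fa_ext (is_poly_fun_algebra hB (wpoly c') Bt)) => o.
  by rewrite ffunE.
have Bp j := fa_biform hB (Bw j) Bz.
have neq0 (J : finType) (x : vec K J) : \prod_i ((x i : K) - 1) = 0 -> x != 0.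
  by move/normalized_neq0/vec_neq0P.
have x0 : lpart z0 != 0.
  have Bx : conv_fun S' (fun o => \prod_i ((lpart (zz o) i : K) - 1)).
    apply: (fa_prod hB) => i; apply: (fa_sub hB) (fa_const hB 1).
    by apply: (fa_ext (Bz (inl i))) => o; rewrite [RHS]ffunE.
  apply: neq0; apply: (lim _ Bx).
  by move=> x n [_ [[_ ?] _ _ _]].
have y0 : rpart z0 != 0.
  have By : conv_fun S' (fun o => \prod_i ((rpart (zz o) i : K) - 1)).
    apply: (fa_prod hB) => i; apply: (fa_sub hB) (fa_const hB 1).
    by apply: (fa_ext (Bz (inr i))) => o; rewrite [RHS]ffunE.
  apply: neq0; apply: (lim _ By).
  by move=> x n [_ [_ [_ ?] _ _]].
have vn0 : v0 != 0.
  have /normalized_neq0 [j vj] : \prod_j (v0 0 j - 1) = 0.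
    apply: (lim (fun o => \prod_j (vv o 0 j - 1))).
      by apply: (fa_prod hB) => j; apply: (fa_sub hB) (fa_const hB 1).
    by move=> x n [_ [_ _ [_ ?] _]].
  by apply/rV0Pn; exists j.
apply: (smooth_nonsingular sm w0 x0 y0 vn0); split=> [j|].
  apply: (lim (fun o => peval (biform (component (w (tt o)) j)) (zz o))); first exact: (Bp j).1.
  by move=> x n [_ [_ _ _ [? _]]].
apply/rowP => k; rewrite mxE [RHS]mxE.
apply: (lim (fun o => \sum_j vv o 0 j * jacobian (w (tt o)) (zz o) j k)).
  apply: (fa_sum hB) => j; apply: (fa_mul hB) => //.
  by apply: (fa_ext ((Bp j).2 (enum_val k))) => o; rewrite mxE.
move=> x n [_ [_ _ _ [_ vJ]]].
by have := congr1 (fun M : 'rV_#|{: V}| => M 0 k) vJ; rewrite mxE [in RHS]mxE.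
Qed.

End SmoothOpen.

(** * Polynomial paths in the incidence variety *)

Section Irreducible.
Variables (K : numClosedFieldType) (a1 a2 m : nat) (A : 'M[nat]_(2, m)) (d1 d2 : nat).
Hypotheses (d1le : (d1 <= 1)%N) (d2le : (d2 <= 1)%N) (d12 : d1 = 1%N \/ d2 = 1%N).
Let Cc := ('I_a1.+1 * mon 1 d1 + 'I_a2.+1 * mon 1 d2)%type.
Let W := vec K (coords (section_space K a1 a2 A)).

Lemma curve_sub_zero_locus (C : curve_space K a1 a2 d1 d2) (s : section_space K a1 a2 A)
    (z : vec K Cc) (w : W) :
  rep (curve_space K a1 a2 d1 d2) z C -> rep (section_space K a1 a2 A) w s ->
  curve_set C `<=` zero_locus s <->
  restr A (lpart z) (rpart z) *m wcol w = 0.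
Proof.
move=> [emb Ce] ws; rewrite /curve_set Ce; have [nda ndb] := embedding_nondeg emb.
apply: iff_trans (iff_sym (restr_ker (lpart z) (rpart z) w)).
split=> [sub j p|H q [p [p0 q1 q2]]].
  (* The zero vector is no point of the line, but the kernel condition ranges over all of K^2; there
     the test points are used instead. *)
  have [->|p0] := eqVneq p 0.
    apply: curve_value_eq0 => k.
    have qs := sub (ppoint (nda _ (pt_neq0 K k)), ppoint (ndb _ (pt_neq0 K k))).
    apply: (qs _ (pjoin (binary_map (lpart z) (pt K k)) (binary_map (rpart z) (pt K k)))) => //.
      by exists (pt K k); split=> //; apply: pt_neq0.
    by split; rewrite ?lpart_pjoin ?rpart_pjoin.
  have qs := sub (ppoint (nda _ p0), ppoint (ndb _ p0)).
  apply: (qs _ (pjoin (binary_map (lpart z) p) (binary_map (rpart z) p))) => //.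
    by exists p.
  by split; rewrite ?lpart_pjoin ?rpart_pjoin.
apply: (@zero_locusP _ _ _ _ _ _ w q
  (pjoin (binary_map (lpart z) p) (binary_map (rpart z) p))) => //.
  by split; rewrite ?lpart_pjoin ?rpart_pjoin.
by move=> j; apply: H.
Qed.

Definition curve_of (z : vec K Cc) (nda : nondeg (lpart z)) (ndb : nondeg (rpart z)) :
    curve_space K a1 a2 d1 d2 :=
  exist (fun C : set (biproj K a1 a2) => exists (al : vec K ('I_a1.+1 * mon 1 d1)%type)
       (be : vec K ('I_a2.+1 * mon 1 d2)%type), parametrizes al be C)
    (curve_image (lpart z) (rpart z))
    (ex_intro _ (lpart z) (ex_intro _ (rpart z)
      (conj (nondeg_embedding d12 nda ndb) (erefl _)))).

Lemma rep_curve_of z nda ndb : rep (curve_space K a1 a2 d1 d2) z (@curve_of z nda ndb).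
Proof. by split=> //; apply: nondeg_embedding. Qed.

Lemma section_point (w : W) : (forall j, component w j != 0) ->
  exists s, rep (section_space K a1 a2 A) w s.
Proof. by move=> w0; exists (fun j => ppoint (w0 j)). Qed.

Lemma rep_scale (w : W) s c : c != 0 -> rep (section_space K a1 a2 A) w s ->
  rep (section_space K a1 a2 A) (c *: w) s.
Proof.
move=> c0 ws j; move: (ws j) => /= <-.
have -> : component (c *: w) j = c *: component w j.
  by apply/ffunP => i; rewrite !ffunE.
exact: line_scale.
Qed.

Lemma fa_restr X (B : (X -> K) -> Prop) (z : X -> vec K Cc) : fun_algebra B ->
  (forall i, B (fun x => z x i)) ->
  forall r c, B (fun x => restr A (lpart (z x)) (rpart (z x)) r c).
Proof.
move=> hB Bz r c.
have Bxm n b (mu : mon n b) (y : 'I_n.+1 -> X -> K) :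
    (forall i, B (y i)) -> B (fun x => xmono mu (fun i => y i x)).
  by move=> By; apply: (fa_prod hB) => i; apply: (fa_exp hB).
have Bmap a d (ga : X -> vec K ('I_a.+1 * mon 1 d)%type) p i :
    (forall k, B (fun x => ga x k)) -> B (fun x => binary_map (ga x) p i).
  move=> Bg; apply: (@fa_ext _ _ _ (fun x => \sum_(mu : mon 1 d) (ga x (i, mu) : K) * xmono mu p)).
    by apply: (fa_sum hB) => mu; apply: (fa_mul hB) (fa_const hB _).
  by move=> x; rewrite binary_mapE.
apply: (@fa_ext _ _ _ (fun x => restr_coef (lpart (z x)) (rpart (z x)) (enum_val r) (enum_val c)))
  => [|x]; last by rewrite mxE.
rewrite /restr_coef; case: (tag (enum_val r) == tag (enum_val c)); last exact: (fa_const hB).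
apply: (fa_mul hB); apply: Bxm => i; apply: Bmap => k.
  by apply: (fa_ext (Bz (inl k))) => x; rewrite ffunE.
by apply: (fa_ext (Bz (inr k))) => x; rewrite ffunE.
Qed.

Definition cvec (u : 'cV[K]_#|secs a1 a2 A|) : W := [ffun c => u (enum_rank c) 0].

Lemma cvec_wcol w : cvec (wcol w) = w.
Proof. by apply/ffunP => c; rewrite ffunE mxE enum_rankK. Qed.

Lemma cvec_scale c u : cvec (c *: u) = c *: cvec u.
Proof. by apply/ffunP => i; rewrite vec_scaleE !ffunE mxE. Qed.

(** A point off a closed set has a basic open neighbourhood f != 0 avoiding it; a single f serves
    for all representatives of all nearby points. *)
Lemma rep_inv (T : coord_space K) (Z : set T) (t : T) (z : vec K (coords T)) :
  zclosed Z -> rep T z t -> ~ Z t ->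
  exists f, peval f z != 0 /\ forall t' z', rep T z' t' -> peval f z' != 0 -> ~ Z t'.
Proof.
move=> [F FP] zt nZ.
have [f [Ff fz]] : exists f, F f /\ peval f z != 0.
  apply: contrapT => H; apply: nZ; apply/(FP z t zt) => f Ff.
  by apply: contrapT => /eqP fz; apply: H; exists f.
exists f; split=> // t' z' z't' fz' Zt'; case/eqP: fz'.
by move/(FP z' t' z't'): Zt'; apply.
Qed.

Lemma rep_curve (C : curve_space K a1 a2 d1 d2) :
  exists z : vec K Cc, rep (curve_space K a1 a2 d1 d2) z C.
Proof.
case: (svalP C) => al [be albe]; exists (pjoin al be).
by rewrite /= lpart_pjoin rpart_pjoin.
Qed.

Lemma rep_section (s : section_space K a1 a2 A) :
  exists w : W, rep (section_space K a1 a2 A) w s.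
Proof.
have H j : exists v : vec K (bimon a1 a2 (A ord0 j) (A ord_max j)), <[v]>%VS = val (s j).
  case: (s j) => L /= L1.
  have := vbasisP L; move: (vbasis L); rewrite (eqP L1) => b /andP [/eqP bL _].
  by exists b`_0; rewrite -bL; case: b {bL} => -[|v [|]] //= _; rewrite span_seq1.
pose v j := sval (cid (H j)); pose vP j := svalP (cid (H j)).
pose w : W := [ffun c => v (tag c) (tagged c)].
by exists w => j; move: (vP j) => /= <-; congr <[_]>%VS; apply/ffunP => i; rewrite !ffunE.
Qed.

Lemma curve_set_nonempty (C : curve_space K a1 a2 d1 d2) : curve_set C !=set0.
Proof.
have [z [emb Ce]] := rep_curve C; have [nda ndb] := embedding_nondeg emb.
exists (ppoint (nda _ (pt_neq0 K 0)), ppoint (ndb _ (pt_neq0 K 0))).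
by rewrite /curve_set Ce; exists (pt K 0); split=> //; apply: pt_neq0.
Qed.

Lemma is_poly_neq0 (h : K -> K) t : is_poly h -> h t != 0 ->
  exists2 p : {poly K}, p != 0 & forall t, p.[t] != 0 -> h t != 0.
Proof.
move=> [p hp]; rewrite hp => pt; exists p => [|s]; last by rewrite hp.
by apply: contraNneq pt => ->; rewrite horner0.
Qed.

(* Two points of the incidence variety are joined by the path that interpolates the
   curves linearly and moves the equations along by Cramer's rule. *)
Lemma incidence_irreducible : locally_compact K ->
  zirreducible (incidence K a1 a2 d1 d2 A).
Proof.
move=> lcK Z1 Z2 cl1 cl2 JZ; apply: contrapT => /not_orP [].
move=> /existsNP [[C1 s1] /not_implyP [[/= sm1 sub1] n1]].
move=> /existsNP [[C2 s2] /not_implyP [[/= sm2 sub2] n2]].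
have [z1 z1C] := rep_curve C1; have [z2 z2C] := rep_curve C2.
have [w1 w1s] := rep_section s1; have [w2 w2s] := rep_section s2.
have E1 := (curve_sub_zero_locus z1C w1s).1 sub1.
have E2 := (curve_sub_zero_locus z2C w2s).1 sub2.
have [na1 nb1] := embedding_nondeg z1C.1; have [na2 nb2] := embedding_nondeg z2C.1.
have [f1 _ f1d] := row_free_pivot (restr_row_free A d1le d2le na1 nb1).
have [f2 _ f2d] := row_free_pivot (restr_row_free A d1le d2le na2 nb2).
pose z (t : K) : vec K Cc := (1 - t) *: z1 + t *: z2.
pose E t := restr A (lpart (z t)) (rpart (z t)).
(* The pivots [f1] are adapted to the curve at t = 0, [f2] to that at t = 1. At each end a single
   term survives, and it is a nonzero multiple of the given equations. *)
pose w (t : K) : W := (1 - t) *: cvec (kernel_param (E t) f1 (wcol w1)) +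
                      t *: cvec (kernel_param (E t) f2 (wcol w2)).
have hP := is_poly_algebra K.
have idP := is_poly_id K.
have subP : is_poly (fun t : K => 1 - t) by apply: (fa_sub hP) (fa_const hP 1) idP.
have zP i : is_poly (fun t => z t i).
  apply: (@fa_ext _ _ _ (fun t => (1 - t) * (z1 i : K) + t * (z2 i : K))) => [|t].
    by apply: (fa_add hP); apply: (fa_mul hP) => //; apply: (fa_const hP).
  by rewrite [in RHS]ffunE !vec_scaleE.
have EP i j : is_poly (fun t => E t i j) by apply: (fa_restr hP zP).
have kP f (u : 'cV[K]_#|secs a1 a2 A|) i j : is_poly (fun t => kernel_param (E t) f u i j).
  by apply: (fa_kernel_param (u := fun=> u) f hP EP _).2 => *; apply: (fa_const hP).
have wP i : is_poly (fun t => w t i).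
  apply: (@fa_ext _ _ _ (fun t => (1 - t) * kernel_param (E t) f1 (wcol w1) (enum_rank i) 0
     + t * kernel_param (E t) f2 (wcol w2) (enum_rank i) 0)) => [|t].
    by apply: (fa_add hP); apply: (fa_mul hP).
  by rewrite [in RHS]ffunE !vec_scaleE [in RHS]ffunE [X in _ = _ + _ * X]ffunE.
have zero : z 0 = z1 by rewrite /z subr0 scale1r scale0r addr0.
have zone : z 1 = z2 by rewrite /z subrr scale1r scale0r add0r.
have w0 : w 0 = \det (pivot_minor (E 0) f1) *: w1.
  rewrite /w subr0 scale1r scale0r addr0 kernel_param_ker ?cvec_scale ?cvec_wcol //.
  by rewrite /E zero.
have wone : w 1 = \det (pivot_minor (E 1) f2) *: w2.
  rewrite /w subrr scale1r scale0r add0r kernel_param_ker ?cvec_scale ?cvec_wcol //.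
  by rewrite /E zone.
rewrite -zero -/(E 0) in f1d; rewrite -zone -/(E 1) in f2d.
have w0s : rep (section_space K a1 a2 A) (w 0) s1 by rewrite w0; apply: rep_scale.
have w1s' : rep (section_space K a1 a2 A) (w 1) s2 by rewrite wone; apply: rep_scale.
have Ew t : E t *m wcol (w t) = 0.
  have -> : wcol (w t) = (1 - t) *: kernel_param (E t) f1 (wcol w1) +
                         t *: kernel_param (E t) f2 (wcol w2).
    apply/matrixP => i j; rewrite ord1 [LHS]mxE ffunE !vec_scaleE ffunE.
    by rewrite [X in _ + _ * X]ffunE enum_valK !mxE.
  by rewrite mulmxDr -!scalemxAr !mul_kernel_param !scaler0 addr0.
have rep0 : rep (prod_space (curve_space K a1 a2 d1 d2) (section_space K a1 a2 A))
    (pjoin (z 0) (w 0)) (C1, s1).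
  by split; rewrite ?lpart_pjoin ?rpart_pjoin //= zero.
have rep1 : rep (prod_space (curve_space K a1 a2 d1 d2) (section_space K a1 a2 A))
    (pjoin (z 1) (w 1)) (C2, s2).
  by split; rewrite ?lpart_pjoin ?rpart_pjoin //= zone.
have [g1 [g1z g1P]] := rep_inv cl1 rep0 n1.
have [g2 [g2z g2P]] := rep_inv cl2 rep1 n2.
have pwP i : is_poly (fun t => pjoin (z t) (w t) i).
  by case: i => i; [apply: (fa_ext (zP i))|apply: (fa_ext (wP i))] => t; rewrite [RHS]ffunE.
have gP g : is_poly (fun t => peval g (pjoin (z t) (w t))).
  exact: (fa_meval hP g (fun k => pwP (enum_val k))).
have [p1 p1n p1P] := is_poly_neq0 (gP g1) g1z.
have [p2 p2n p2P] := is_poly_neq0 (gP g2) g2z.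
have [ha [ha0 haP haA]] := nondeg_open d1le na1.
have [hb [hb0 hbP hbA]] := nondeg_open d2le nb1.
have aP : is_poly (fun t => ha (lpart (z t))).
  by apply: haA hP _ => i; apply: (fa_ext (zP (inl i))) => t; rewrite [RHS]ffunE.
have bP : is_poly (fun t => hb (rpart (z t))).
  by apply: hbA hP _ => i; apply: (fa_ext (zP (inr i))) => t; rewrite [RHS]ffunE.
have az : ha (lpart (z 0)) != 0 by rewrite zero.
have bz : hb (rpart (z 0)) != 0 by rewrite zero.
have [p3 p3n p3P] := is_poly_neq0 aP az.
have [p4 p4n p4P] := is_poly_neq0 bP bz.
(* No component of w t may vanish if it is to represent a point of the product of projective
   spaces. *)
have [q qn qP] : exists2 q : {poly K}, q != 0 &
    forall t, q.[t] != 0 -> forall j, component (w t) j != 0.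
  have H j : exists q : {poly K}, q != 0 /\ forall t, q.[t] != 0 -> component (w t) j != 0.
    have /vec_neq0P [i wi] := rep_neq0 (w0s j).
    have cP : is_poly (fun t => component (w t) j i).
      by apply: (fa_ext (wP (sec i))) => t; rewrite [RHS]ffunE.
    have [q qn qP] := is_poly_neq0 cP wi.
    by exists q; split=> // t /qP qt; apply/vec_neq0P; exists i.
  have [q qH] := fin_all_exists H.
  exists (\prod_j q j) => [|t]; first by apply/prodf_neq0 => j _; case: (qH j).
  rewrite horner_prod => /prodf_neq0 qt j.
  by apply: (qH j).2; apply: qt.
(* That [p2] is nonzero is seen at t = 1, but a nonzero polynomial also has nonroots near 0, where
   smoothness is inherited from s1. *)
have Pn : p1 * p2 * p3 * p4 * q != 0 by rewrite !mulf_neq0.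
have [t [Pt smt]] := smooth_open_path lcK wP w0s sm1 Pn.
move: Pt; rewrite !hornerM !mulf_eq0 !negb_or -!andbA.
move=> /and5P [/p1P t1 /p2P t2 /p3P t3 /p4P t4 /qP tq].
have [s ws] := section_point tq.
pose C := curve_of (haP _ t3) (hbP _ t4).
have zC : rep (curve_space K a1 a2 d1 d2) (z t) C by apply: rep_curve_of.
have sub := (curve_sub_zero_locus zC ws).2 (Ew t).
have rept : rep (prod_space (curve_space K a1 a2 d1 d2) (section_space K a1 a2 A))
    (pjoin (z t) (w t)) (C, s).
  by split; rewrite ?lpart_pjoin ?rpart_pjoin.
have smt' : smooth_ci s.
  by apply: smt ws _; have [x Cx] := curve_set_nonempty C; exists x; apply: sub.
have [] := JZ (C, s) (conj smt' sub); [exact: g1P rept t1 | exact: g2P rept t2].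
Qed.

End Irreducible.

(** * Finiteness *)

Section NormalForm.
Variables (K : numClosedFieldType).

Definition act2 (g : 'I_2 -> 'I_2 -> K) (p : vec K 'I_2) : vec K 'I_2 :=
  [ffun k => \sum_l g k l * (p l : K)].

Lemma subst_binary_map a d (al : vec K ('I_a.+1 * mon 1 d)%type) g : (d <= 1)%N ->
  exists al' : vec K ('I_a.+1 * mon 1 d)%type,
    forall p, binary_map al' p = binary_map al (act2 g p).
Proof.
case: d al => [|[|//]] al _.
  by exists al => p; apply/ffunP => i; rewrite !binary_map0E.
(* The exponent of the variable l in a monomial of degree 1 is 1 or 0, so the inner sum selects the
   entry of g that belongs to this monomial. *)
pose al' : vec K ('I_a.+1 * mon 1 1)%type := [ffun im : 'I_a.+1 * mon 1 1 =>
  \sum_k (al (im.1, mon1 k) : K) * \sum_l g k l * ((val im.2 : 'X_{1..2}) l)%:R].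
exists al' => p; apply/ffunP => i; rewrite !binary_map1E.
have al'E l : al' (i, mon1 l) = \sum_k (al (i, mon1 k) : K) * g k l.
  rewrite ffunE; apply: eq_bigr => k _; congr (_ * _).
  rewrite (bigD1 l) //= mnm1E eqxx mulr1 big1 ?addr0 // => l' ll'.
  by rewrite mnm1E eq_sym (negbTE ll') mulr0.
under eq_bigr => l _ do rewrite al'E mulr_suml.
rewrite exchange_big; apply: eq_bigr => k _; rewrite ffunE mulr_sumr.
by apply: eq_bigr => l _; rewrite mulrA.
Qed.

(** The rows i and j of a nonzero minor form an invertible 2 x 2 matrix h. Substituting its inverse
    g turns these two coordinates of the map into the variables themselves. *)
Lemma nondeg_normalize a (al : vec K ('I_a.+1 * mon 1 1)%type) : nondeg al ->
  exists g h i j, [/\ i != j, forall p, act2 g (act2 h p) = p /\ act2 h (act2 g p) = p &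
    forall p, binary_map al (act2 g p) i = p ord0 /\
              binary_map al (act2 g p) j = p ord_max].
Proof.
move=> /nondeg1P [i [j D0]].
have [x [y [x' [y' [Ex Ey Ex' Ey']]]]] : exists x y x' y' : K,
    [/\ al (i, mon1 ord0) = x, al (i, mon1 ord_max) = y,
        al (j, mon1 ord0) = x' & al (j, mon1 ord_max) = y'].
  by exists (al (i, mon1 ord0)), (al (i, mon1 ord_max)), (al (j, mon1 ord0)),
    (al (j, mon1 ord_max)).
have ij : i != j by apply: contraNneq D0 => ij; rewrite /minor1 ij mulrC subrr.
rewrite /minor1 Ex Ey Ex' Ey' in D0; set D := _ - _ in D0.
pose h (k l : 'I_2) : K := if k == ord0 then if l == ord0 then x else y
                           else if l == ord0 then x' else y'.
pose g (k l : 'I_2) : K := if k == ord0 then if l == ord0 then y' / D else - y / D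
                           else if l == ord0 then - x' / D else x / D.
exists g, h, i, j; split=> // p; last first.
  rewrite !binary_map1E !sum_ord2 Ex Ey Ex' Ey' !ffunE !sum_ord2 /g /= /D.
  by move: (p _) (p _) => u v; split; field.
by split; apply/ffunP => k; rewrite !ffunE !sum_ord2 !ffunE !sum_ord2;
  case: (ord2P k) => ->; rewrite /g /h /= /D;
  move: (p _) (p _) => u v; field.
Qed.

Lemma binary_map_coef a (al : vec K ('I_a.+1 * mon 1 1)%type) i k :
  (forall p : vec K 'I_2, binary_map al p i = p k) ->
  forall l, al (i, mon1 l) = (l == k)%:R.
Proof.
move=> H l; pose p : vec K 'I_2 := [ffun k => (l == k)%:R].
have := H p; rewrite binary_map1E (bigD1 l) //= big1 ?addr0 => [|l' ll'].
  by rewrite !ffunE eqxx mulr1.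
by rewrite ffunE eq_sym (negbTE ll') mulr0.
Qed.

Lemma act2_0 g : act2 g 0 = 0.
Proof. by apply/ffunP => k; rewrite !ffunE big1 // => l _; rewrite ffunE mulr0. Qed.

Lemma curve_image_act a1 a2 d1 d2 (al al' : vec K ('I_a1.+1 * mon 1 d1)%type)
    (be be' : vec K ('I_a2.+1 * mon 1 d2)%type) g h (c c' : K) :
  c != 0 -> c' != 0 -> (forall p, act2 g (act2 h p) = p /\ act2 h (act2 g p) = p) ->
  (forall p, binary_map al' p = c *: binary_map al (act2 g p)) ->
  (forall p, binary_map be' p = c' *: binary_map be (act2 g p)) ->
  curve_image al' be' = curve_image al be.
Proof.
move=> c0 c'0 gh alE beE; apply/seteqP; split=> q [p [p0 q1 q2]].
  exists (act2 g p); split.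
  - by apply: contraNneq p0 => gp; rewrite -(gh p).2 gp act2_0.
  - by move: q1; rewrite /= alE line_scale.
  - by move: q2; rewrite /= beE line_scale.
exists (act2 h p); split.
- by apply: contraNneq p0 => hp; rewrite -(gh p).1 hp act2_0.
- by rewrite /= alE line_scale // (gh p).1.
- by rewrite /= beE line_scale // (gh p).1.
Qed.

Lemma nondeg_act a d (al al' : vec K ('I_a.+1 * mon 1 d)%type) g h (c : K) :
  c != 0 -> (forall p, act2 g (act2 h p) = p /\ act2 h (act2 g p) = p) ->
  (forall p, binary_map al' p = c *: binary_map al (act2 g p)) ->
  nondeg al -> nondeg al'.
Proof.
move=> c0 gh alE nd p p0; rewrite alE scaler_eq0 (negbTE c0) /=; apply: nd.
by apply: contraNneq p0 => gp; rewrite -(gh p).2 gp act2_0.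
Qed.

Lemma binary_map_scalel a d (al : vec K ('I_a.+1 * mon 1 d)%type) (c : K) p :
  binary_map (c *: al) p = c *: binary_map al p.
Proof.
apply/ffunP => i; rewrite vec_scaleE !binary_mapE mulr_sumr; apply: eq_bigr => mu _.
by rewrite vec_scaleE mulrA.
Qed.

Lemma nondeg_neq0 a d (al : vec K ('I_a.+1 * mon 1 d)%type) : nondeg al ->
  exists c, al c != 0.
Proof.
have [p p0] := exists_vec2 K.
move=> /(_ _ p0) /vec_neq0P [i ui]; apply: contrapT => H; case/eqP: ui.
rewrite binary_mapE big1 // => mu _.
have [->|al0] := eqVneq (al (i, mu)) 0; first by rewrite mul0r.
by case: H; exists (i, mu).
Qed.

(** The prescribed values are 0 and 1, encoded by booleans, so that only finitely many normal forms
    (T, tau) exist. *)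
Definition normal_at (I : finType) (T : {set I}) (tau : {ffun I -> bool}) (z : vec K I) :=
  forall c, c \in T -> z c = (tau c)%:R.

Lemma normal_seq (I : finType) (s : seq I) (t : seq bool) (z : vec K I) : uniq s ->
  size t = size s ->
  (forall k, (k < size s)%N -> forall c, nth c s k = c -> z c = (nth false t k)%:R) ->
  exists (T : {set I}) tau, #|T| = size s /\ normal_at T tau z.
Proof.
move=> us ts H; exists [set x in s], [ffun c => nth false t (index c s)]; split.
  by rewrite cardsE; apply/card_uniqP.
move=> c; rewrite inE => cs; rewrite ffunE; apply: H; first by rewrite index_mem.
by rewrite nth_index.
Qed.

Variables (a1 a2 d1 d2 : nat).
Hypotheses (d1le : (d1 <= 1)%N) (d2le : (d2 <= 1)%N) (d12 : d1 = 1%N \/ d2 = 1%N).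
Let Cc := ('I_a1.+1 * mon 1 d1 + 'I_a2.+1 * mon 1 d2)%type.

(* The reparametrizations of P^1 and the scalings of al and be form a group of
   dimension 5: up to them, five coefficients of the curve take prescribed values. *)
Lemma curve_normal_form (C : curve_space K a1 a2 d1 d2) :
  exists z : vec K Cc, rep (curve_space K a1 a2 d1 d2) z C /\
    exists (T : {set Cc}) tau, #|T| = 5%N /\ normal_at T tau z.
Proof.
have [z0 [emb Ce]] := rep_curve C; have [nda ndb] := embedding_nondeg emb.
have m1 : mon1 (ord0 : 'I_2) != mon1 ord_max.
  by rewrite (inj_eq (bij_inj (mon1_bij 1))).
have [d11|d21] := d12.
  move: z0 emb Ce nda ndb; rewrite /Cc; move: d11 => d11; subst d1.
  move=> z0 emb Ce nda ndb.
  have [g [h [i [j [ij gh galij]]]]] := nondeg_normalize nda.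
  have [al alE] := subst_binary_map (lpart z0) g d1le.
  have [be beE] := subst_binary_map (rpart z0) g d2le.
  have alE' p : binary_map al p = 1 *: binary_map (lpart z0) (act2 g p).
    by rewrite scale1r.
  have beE1 p : binary_map be p = 1 *: binary_map (rpart z0) (act2 g p).
    by rewrite scale1r.
  have [c bec] := nondeg_neq0 (nondeg_act (oner_neq0 K) gh beE1 ndb).
  have bec' : (be c : K)^-1 != 0 by rewrite invr_eq0.
  pose be' := (be c : K)^-1 *: be.
  have beE' p : binary_map be' p = (be c : K)^-1 *: binary_map (rpart z0) (act2 g p).
    by rewrite binary_map_scalel beE.
  exists (pjoin al be'); split.
    split; rewrite lpart_pjoin rpart_pjoin.
      apply: (nondeg_embedding d12).
        exact: (nondeg_act (oner_neq0 K) gh alE' nda).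
      exact: (nondeg_act bec' gh beE' ndb).
    by rewrite Ce (curve_image_act (oner_neq0 K) bec' gh alE' beE').
  have ali := binary_map_coef (fun p => etrans (congr1 (fun v : vec K _ => v i) (alE p)) (galij p).1).
  have alj := binary_map_coef (fun p => etrans (congr1 (fun v : vec K _ => v j) (alE p)) (galij p).2).
  (* The five values are the identity block in rows i and j, which uses up the substitutions and the
     scaling of the first factor, and one coefficient of the second factor scaled to 1. *)
  have [] := @normal_seq _ [:: inl (i, mon1 ord0); inl (i, mon1 ord_max);
      inl (j, mon1 ord0); inl (j, mon1 ord_max); inr c : Cc]
      [:: true; false; false; true; true] (pjoin al be').
  - have inlE (x y : 'I_a1.+1 * mon 1 1) : ((inl x : Cc) == inl y) = (x == y) by [].
    by rewrite /= !inE !inlE !xpair_eqE !eqxx (negbTE m1) (negbTE ij).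
  - by [].
  - case=> [|[|[|[|[|//]]]]] _ x /= <-; rewrite ffunE ?ali ?alj //.
    by rewrite vec_scaleE mulVf.
  - by move=> T [tau []]; exists T, tau.
move: z0 emb Ce nda ndb; rewrite /Cc; move: d21 => d21; subst d2.
move=> z0 emb Ce nda ndb.
have [g [h [i [j [ij gh gbeij]]]]] := nondeg_normalize ndb.
have [al alE] := subst_binary_map (lpart z0) g d1le.
have [be beE] := subst_binary_map (rpart z0) g d2le.
have alE1 p : binary_map al p = 1 *: binary_map (lpart z0) (act2 g p).
  by rewrite scale1r.
have beE' p : binary_map be p = 1 *: binary_map (rpart z0) (act2 g p).
  by rewrite scale1r.
have [c alc] := nondeg_neq0 (nondeg_act (oner_neq0 K) gh alE1 nda).
have alc' : (al c : K)^-1 != 0 by rewrite invr_eq0.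
pose al' := (al c : K)^-1 *: al.
have alE' p : binary_map al' p = (al c : K)^-1 *: binary_map (lpart z0) (act2 g p).
  by rewrite binary_map_scalel alE.
exists (pjoin al' be); split.
  split; rewrite lpart_pjoin rpart_pjoin.
    apply: (nondeg_embedding d12).
      exact: (nondeg_act alc' gh alE' nda).
    exact: (nondeg_act (oner_neq0 K) gh beE' ndb).
  by rewrite Ce (curve_image_act alc' (oner_neq0 K) gh alE' beE').
have bei := binary_map_coef (fun p => etrans (congr1 (fun v : vec K _ => v i) (beE p)) (gbeij p).1).
have bej := binary_map_coef (fun p => etrans (congr1 (fun v : vec K _ => v j) (beE p)) (gbeij p).2).
have [] := @normal_seq _ [:: inr (i, mon1 ord0); inr (i, mon1 ord_max);
    inr (j, mon1 ord0); inr (j, mon1 ord_max); inl c : Cc]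
    [:: true; false; false; true; true] (pjoin al' be).
- have inrE (x y : 'I_a2.+1 * mon 1 1) : ((inr x : Cc) == inr y) = (x == y) by [].
  by rewrite /= !inE !inrE !xpair_eqE !eqxx (negbTE m1) (negbTE ij).
- by [].
- case=> [|[|[|[|[|//]]]]] _ x /= <-; rewrite ffunE ?bei ?bej //.
  by rewrite vec_scaleE mulVf.
- by move=> T [tau []]; exists T, tau.
Qed.

(** * Dimension count, charts and generic finiteness *)

Variables (m : nat) (A : 'M[nat]_(2, m)).
Hypotheses (hm : (m + 3 = a1 + a2)%N) (hA0 : (\sum_j A ord0 j = a1.+1)%N)
  (hA1 : (\sum_j A ord_max j = a2.+1)%N).
Let W := vec K (coords (section_space K a1 a2 A)).

(** By the Calabi-Yau condition there are (a1+1) d1 + (a2+1) d2 + m rows, against (a1+1)(d1+1) +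
    (a2+1)(d2+1) coefficients. The difference is a1 + a2 + 2 - m = 5. *)
Lemma card_curve_coords : #|{: Cc}| = (#|rows A d1 d2| + 5)%N.
Proof.
have cm d : (d <= 1)%N -> #|mon 1 d| = d.+1.
  by case: d => [|[|]] // _; rewrite ?card_mon0 ?card_mon1.
rewrite card_sum !card_prod !card_ord !cm // card_tagged sumnE big_map big_enum /=.
under eq_bigr => j _ do rewrite card_ord -addn1.
rewrite !big_split /= -!big_distrl /= hA0 hA1 sum1_card card_ord.
by move: hm; nia.
Qed.

(** The chart has as coordinates the coefficients off T, as many as there are rows, and the entries
    of u off the pivots, which number the columns minus the rows. The total is the number of
    coordinates of w, so [finite_fibres] applies to Cramer's formula. *)
Lemma finite_chart (T : {set Cc}) (tau : {ffun Cc -> bool})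
    (f : 'I_#|rows A d1 d2| -> 'I_#|secs a1 a2 A|) (i0 : Cc) :
  #|T| = 5%N -> injective f ->
  exists2 h : {mpoly K[#|secs a1 a2 A|]}, h != 0 & forall w : W, peval h w != 0 ->
    exists l : seq K, forall z : vec K Cc, normal_at T tau z ->
      \det (pivot_minor (restr A (lpart z) (rpart z)) f) != 0 ->
      restr A (lpart z) (rpart z) *m wcol w = 0 -> z i0 \in l.
Proof.
move=> T5 f_inj.
pose I1 : finType := {c : Cc | c \notin T}.
pose I2 : finType := {k : 'I_#|secs a1 a2 A| | k \notin codom f}.
pose I : finType := (I1 + I2)%type.
(* Coefficients in T default to their normal value, and below entries at pivots default to 0. *)
pose zx (x : 'I_#|I| -> K) : vec K Cc :=
  [ffun c => if insub c is Some s then x (enum_rank (inl s : I)) else (tau c)%:R].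
pose ux (x : 'I_#|I| -> K) : 'cV[K]_#|secs a1 a2 A| :=
  \col_k if insub k is Some s then x (enum_rank (inr s : I)) else 0.
pose E x := restr A (lpart (zx x)) (rpart (zx x)).
have hP := is_mpoly_algebra K #|I|.
have zP c : is_mpoly (fun x => zx x c).
  case Ec : (insub c : option I1) => [s|].
    by apply: (fa_ext (is_mpoly_var K (enum_rank (inl s : I)))) => x; rewrite ffunE Ec.
  by apply: (fa_ext (fa_const hP (tau c)%:R)) => x; rewrite ffunE Ec.
have uP i j : is_mpoly (fun x => ux x i j).
  case Ec : (insub i : option I2) => [s|].
    by apply: (fa_ext (is_mpoly_var K (enum_rank (inr s : I)))) => x; rewrite mxE Ec.
  by apply: (fa_ext (fa_const hP 0)) => x; rewrite mxE Ec.
have EP i j : is_mpoly (fun x => E x i j) by apply: (fa_restr hP zP).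
have kP k : is_mpoly (fun x => kernel_param (E x) f (ux x) k 0).
  exact: (fa_kernel_param f hP EP uP).2.
have cI : (#|I| <= #|secs a1 a2 A|)%N.
  have c1 : #|I1| = #|rows A d1 d2|.
    have := cardC (mem T); rewrite card_curve_coords card_sig T5.
    have -> : #|[predC T]| = #|[pred c | c \notin T]| by apply: eq_card.
    by lia.
  have c2 : (#|rows A d1 d2| + #|I2| = #|secs a1 a2 A|)%N.
    have e := cardC (mem (codom f)); rewrite card_ord in e.
    rewrite card_sig; apply: etrans e; congr (_ + _)%N.
    by rewrite (card_codom f_inj) card_ord.
  by rewrite card_sum c1 c2.
have [h h0 hP'] := finite_fibres cI kP (zP i0).
exists h => // w hw; have [l lP] := hP' _ hw.
exists l => z nz dz Ez.
(* On the kernel Cramer's formula multiplies by the minor d, so starting from w / d returns w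
   itself. Subtracting the pivot entries then matches the default 0. *)
set d := \det _ in dz; pose u0 := d^-1 *: wcol w.
pose u := u0 - pivot_ext K f *m (\col_k u0 (f k) 0).
have [Qf Qn] := pivot_ext_mul (\col_k u0 (f k) 0 : 'cV[K]__) f_inj.
pose x (k : 'I_#|I|) : K := match enum_val k with inl s => z (val s) | inr s => u (val s) 0 end.
have zxx : zx x = z.
  apply/ffunP => c; rewrite ffunE; case: insubP => [s _ sc|].
    by rewrite /x enum_rankK sc.
  by rewrite negbK => cT; rewrite nz.
have uxx : ux x = u.
  apply/matrixP => k j; rewrite ord1 mxE; case: insubP => [s _ sk|].
    by rewrite /x enum_rankK sk.
  rewrite negbK => /codomP [k' ->].
  by rewrite /u [RHS]mxE [X in _ = _ + X]mxE Qf [X in _ = _ - X]mxE subrr.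
rewrite -zxx; apply: lP => k; rewrite /E zxx uxx /u kernel_param_pivot.
rewrite kernel_param_ker; last by rewrite -scalemxAr Ez scaler0.
by rewrite scalerA mulfV // scale1r mxE.
Qed.

(** Full row rank puts every normalized curve in some chart. The product of the finitely many
    exceptional polynomials and the concatenation of the lists serve all charts at once. *)
Lemma finite_charts :
  exists2 h : {mpoly K[#|secs a1 a2 A|]}, h != 0 & forall w : W, peval h w != 0 ->
    exists l : seq K, forall (z : vec K Cc) (T : {set Cc}) tau i0, #|T| = 5%N ->
      normal_at T tau z -> nondeg (lpart z) -> nondeg (rpart z) ->
      restr A (lpart z) (rpart z) *m wcol w = 0 -> z i0 \in l.
Proof.
pose X : finType := ({set Cc} * {ffun Cc -> bool} *
  {ffun 'I_#|rows A d1 d2| -> 'I_#|secs a1 a2 A|} * Cc)%type.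
pose ok (x : X) := #|x.1.1.1| = 5%N /\ injective x.1.2.
have H (x : X) : exists h : {mpoly K[#|secs a1 a2 A|]}, h != 0 /\
    (ok x -> forall w : W, peval h w != 0 -> exists l : seq K, forall z : vec K Cc,
      normal_at x.1.1.1 x.1.1.2 z ->
      \det (pivot_minor (restr A (lpart z) (rpart z)) x.1.2) != 0 ->
      restr A (lpart z) (rpart z) *m wcol w = 0 -> z x.2 \in l).
  have [[x5 xf]|nok] := pselect (ok x); last first.
    by exists 1; split=> [|//]; apply: oner_neq0.
  by have [h h0 hP] := finite_chart x.1.1.2 x.2 x5 xf; exists h.
have [h hP] := fin_all_exists H.
exists (\prod_x h x) => [|w]; first by apply/prodf_neq0 => x _; case: (hP x).
rewrite /peval rmorph_prod => /prodf_neq0 hw.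
have H' (x : X) : exists l : seq K, ok x -> forall z : vec K Cc,
      normal_at x.1.1.1 x.1.1.2 z ->
      \det (pivot_minor (restr A (lpart z) (rpart z)) x.1.2) != 0 ->
      restr A (lpart z) (rpart z) *m wcol w = 0 -> z x.2 \in l.
  have [okx|nok] := pselect (ok x); last by exists [::].
  by have [l lP] := (hP x).2 okx w (hw x isT); exists l.
have [l lP] := fin_all_exists H'.
exists (flatten [seq l x | x <- enum X]) => z T tau i0 T5 nz nda ndb Ez.
have [f f_inj fd] := row_free_pivot (restr_row_free A d1le d2le nda ndb).
pose x : X := (T, tau, finfun f, i0).
apply/flatten_mapP; exists x; first by rewrite mem_enum.
apply: (lP x) => //=.
  by split=> //= k k'; rewrite !ffunE => /f_inj.
by rewrite (_ : (finfun f : _ -> _) = f) //; apply/funext => k; rewrite ffunE.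
Qed.

Lemma finite_vec_in (I : finType) (l : seq K) :
  finite_set [set z : vec K I | forall i, z i \in l].
Proof.
pose F (g : {ffun I -> 'I_(size l)}) : vec K I := [ffun i => l`_(g i)].
apply: (sub_finite_set _ (finite_image F (finite_finset (X := setT)))) => z zl.
have zi i : (index (z i) l < size l)%N by rewrite index_mem; apply: zl.
exists [ffun i => Ordinal (zi i)] => //; apply/ffunP => i.
by rewrite !ffunE /= nth_index // ; apply: zl.
Qed.

Lemma rep_curve_inj (C C' : curve_space K a1 a2 d1 d2) z :
  rep (curve_space K a1 a2 d1 d2) z C -> rep (curve_space K a1 a2 d1 d2) z C' -> C = C'.
Proof.
case: C => C HC; case: C' => C' HC' [_ /= e] [_ /= e']; subst C C'.
by congr exist; apply: Prop_irrelevance.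
Qed.

Definition sec_scale (lam : 'I_m -> K) (w : W) : W := [ffun c => lam (tag c) * (w c : K)].

(** Over w off the zeros of h all coefficients of a normalized curve lie in one finite list, and
    these coefficients determine the curve. *)
Lemma generic_finite : (exists W0 : set (section_space K a1 a2 A),
    [/\ zopen W0, W0 !=set0 & forall s, W0 s -> smooth_ci s]) ->
  exists U : set (section_space K a1 a2 A),
    [/\ zopen U, U `&` [set s | smooth_ci s] !=set0 &
      forall s, U s -> finite_set [set C : curve_space K a1 a2 d1 d2 |
                                   curve_set C `<=` zero_locus s]].
Proof.
move=> [W0 [W0o [s0 W0s0] W0sm]].
have [h h0 hP] := finite_charts.
pose U : set (section_space K a1 a2 A) :=
  [set s | exists w : W, rep (section_space K a1 a2 A) w s /\ peval h w != 0].
exists U; split.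
(* The polynomial h need not be multihomogeneous. A point is outside U when h vanishes at all its
   representatives, that is, when all rescalings of h vanish at one of them. *)
- exists [set f | exists lam : 'I_m -> K, (forall j, lam j != 0) /\
      forall w : W, peval f w = peval h (sec_scale lam w)] => w s ws.
  split=> [nU f [lam [lam0 fE]]|H [w' [w's hw']]].
    apply: contrapT => /eqP fw; apply: nU; exists (sec_scale lam w).
    split; last by rewrite -fE.
    move=> j; move: (ws j) => /= <-.
    have -> : component (sec_scale lam w) j = lam j *: component w j.
      by apply/ffunP => i; rewrite vec_scaleE !ffunE.
    exact: line_scale.
  have [lam lamP] := rep_component ws w's.
  have w'E : w' = sec_scale lam w.
    apply/ffunP => -[j i]; have := congr1 (fun v : vec K _ => v i) (lamP j).2.
    by rewrite vec_scaleE !ffunE.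
  have hM := is_mpoly_algebra K #|secs a1 a2 A|.
  have [f fE] : is_mpoly (fun x : 'I_#|secs a1 a2 A| -> K =>
      h.@[fun k => lam (tag (enum_val k)) * x k]).
    apply: (fa_meval hM) => k; apply: (fa_mul hM (fa_const hM _)).
    exact: is_mpoly_var.
  have fE' (v : W) : peval f v = peval h (sec_scale lam v).
    by rewrite /peval -fE; apply: meval_eq => k; rewrite ffunE.
  case/eqP: hw'; rewrite w'E -fE'; apply: H; exists lam; split=> // j.
  exact: (lamP j).1.
- have [w0 w0s] := rep_section s0.
  have [f [fw fP]] := rep_inv W0o w0s (fun nW => nW W0s0).
  have f0 : f != 0 by apply: contraNneq fw => ->; rewrite /peval meval0.
  have [c cP] : exists c : 'I_m -> secs a1 a2 A, forall j, tag (c j) = j.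
    apply: (@fin_all_exists _ (fun=> secs a1 a2 A) (fun j c => tag c = j)) => j.
    by have /vec_neq0P [i _] := rep_neq0 (w0s j); exists (sec i).
  (* One coordinate is taken from each section, so that g(w) != 0 forces every component of w to be
     nonzero. A common nonzero of h, f and g then gives a smooth point of U. *)
  pose g : {mpoly K[#|secs a1 a2 A|]} := \prod_j pvar K (c j).
  have g0 : g != 0.
    apply/prodf_neq0 => j _; apply: contraTneq (oner_neq0 K) => e.
    have := congr1 (meval (fun=> 1)) e; rewrite mevalXU meval0 => ->.
    by rewrite eqxx.
  have Pn : h * f * g != 0 by rewrite !mulf_neq0.
  have [v] := mpoly_nonroot Pn; rewrite !mevalM !mulf_eq0 !negb_or -andbA => /and3P [hv fv gv].
  pose w : W := [ffun c => v (enum_rank c)].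
  have wE p : peval p w = p.@[v] by apply: meval_eq => k; rewrite ffunE enum_valK.
  have [s ws] : exists s, rep (section_space K a1 a2 A) w s.
    apply: section_point => j; apply/vec_neq0P.
    move: gv; rewrite rmorph_prod => /prodf_neq0 /(_ j isT); rewrite /= /pvar mevalXU.
    case: (c j) (cP j) => j' i /= jj'; subst j' => vi.
    by exists i; rewrite !ffunE.
  exists s; split; first by exists w; rewrite wE.
  by apply: W0sm; apply: contrapT; apply: (fP s w ws); rewrite wE.
move=> s [w [ws hw]]; have [l lP] := hP w hw.
(* Choosing a normal form for each curve embeds the set of curves injectively into the finite set of
   vectors with entries in l. *)
have /choice [zf zfP] := curve_normal_form.
apply: (@sub_finite_set _ _ (zf @^-1` [set z | forall i, z i \in l])).
  move=> C sub i; have [zC [T [tau [T5 nz]]]] := zfP C.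
  have [nda ndb] := embedding_nondeg zC.1.
  by apply: (lP _ _ _ _ T5 nz nda ndb); apply: (curve_sub_zero_locus zC ws).1.
apply: finite_preimage; last exact: finite_vec_in. move=> C C' _ _ e.
have [zC _] := zfP C; have [zC' _] := zfP C'.
by rewrite -e in zC'; apply: rep_curve_inj zC zC'.
Qed.

End NormalForm.

Theorem theorem9 (R : realType) (a1 a2 m : nat) (A : 'M[nat]_(2, m))
    (ha1 : (0 < a1)%N) (ha2 : (0 < a2)%N)
    (hA : configuration_matrix R[i] a1 a2 A)
    (d1 d2 : nat)
    (hd : (d1, d2) \in [:: (0, 1); (1, 0); (1, 1)]%N) :
  zirreducible (incidence R[i] a1 a2 d1 d2 A) /\
  exists W : set (section_space R[i] a1 a2 A),
    [/\ zopen W,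
        W `&` [set s | smooth_ci s] !=set0 &
        forall s, W s -> smooth_ci s ->
          finite_set [set C : curve_space R[i] a1 a2 d1 d2 |
                       curve_set C `<=` zero_locus s]].
Proof.
have [d1le d2le d12] : [/\ (d1 <= 1)%N, (d2 <= 1)%N & d1 = 1%N \/ d2 = 1%N].
  by move: hd; rewrite !inE !xpair_eqE => /or3P[] /andP[/eqP-> /eqP->]; split; auto.
have [[_ hm] _ hA0 hA1 [W0 [W0o W0n W0sm]]] := hA.
split; first exact: (incidence_irreducible d1le d2le d12 (complex_locally_compact R)).
have [|W [Wo Wn Wfin]] := generic_finite d1le d2le d12 hm hA0 hA1 (K := R[i]).
  by exists W0; split=> // s /W0sm [].
by exists W; split=> // s Ws _; apply: Wfin.
Qed.
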